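(* Let $\varphi$ be a $G_2$-structure with associated metric $g$ on a smooth $7$-dimensional manifold $M$. Then for any nowhere-vanishing octonion section $V\in\Gamma(\mathbb{O}M)$, $$\sigma_{V^3}(\varphi)(\cdot,\cdot,\cdot)=\varphi\left(\mathrm{Ad}_{V^{-1}}\cdot,\ \mathrm{Ad}_{V^{-1}}\cdot,\ \mathrm{Ad}_{V^{-1}}\cdot\right),$$ where on the right-hand side $\mathrm{Ad}_{V^{-1}}$ is restricted to imaginary octonions (i.e. vector fields).
   Context: Setting. A $G_2$-structure on a smooth $7$-manifold $M$ is identified with a positive $3$-form $\varphi$, i.e. one that at each point lies in the $GL(7,\mathbb{R})$-orbit of $\varphi_0=e^{123}+e^{145}+e^{167}+e^{246}-e^{257}-e^{347}-e^{356}$. It determines a unique Riemannian metric $g$ and volume form $\mathrm{vol}$ (hence an orientation) by $g(u,v)\,\mathrm{vol}=\frac16(u\lrcorner\varphi)\wedge(v\lrcorner\varphi)\wedge\varphi$, where $\lrcorner$ is contraction. Let $*$ be the Hodge star and $\psi=*\varphi$. Octonion bundle. $\mathbb{O}M=\Lambda^0\oplus TM$, where $\Lambda^0$ is the trivial real line bundle; an octonion section is $A=(a,\alpha)$ with $\mathrm{Re}A=a$ a function and $\mathrm{Im}A=\alpha$ a vector field; vector fields are identified with imaginary octonion sections. Conjugate: $\bar A=(a,-\alpha)$. Inner product: $\langle (a,\alpha),(b,\beta)\rangle=ab+g(\alpha,\beta)$. Cross product: $\langle\alpha\times\beta,\gamma\rangle=\varphi(\alpha,\beta,\gamma)$. Octonion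 product with respect to $\varphi$: $AB=(ab-\langle\alpha,\beta\rangle,\ a\beta+b\alpha+\alpha\times\beta)$. This is fiberwise the octonion algebra (non-associative, alternative); for nowhere-vanishing $V$, $V^{-1}=\bar V/|V|^2$. For nowhere-vanishing $V$, $\mathrm{Ad}_V A=VAV^{-1}$ (unambiguous by alternativity); it maps imaginary octonions to imaginary octonions. For a nowhere-vanishing octonion section $A=(a,\alpha)$, define $$\sigma_A(\varphi)=\frac{1}{|A|^2}\left((a^2-|\alpha|^2)\varphi-2a\,\alpha\lrcorner( *\varphi)+2\alpha\wedge(\alpha\lrcorner\varphi)\right),$$ where in the wedge product $\alpha$ denotes the $1$-form dual to the vector field $\alpha$ via $g$. *)

(* Defs.v *)
From HB Require Import structures.
From mathcomp Require Import all_boot all_order all_algebra all_fingroup.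
From mathcomp Require Import all_classical all_reals all_analysis.

Set Implicit Arguments.
Unset Strict Implicit.
Unset Printing Implicit Defensive.

Import Order.TTheory GRing.Theory Num.Theory.
Import numFieldNormedType.Exports.

Local Open Scope classical_set_scope.
Local Open Scope ring_scope.

Section Euclidean.
Variable R : realType.

(* Meant for open U, so that the partial derivatives at points of U depend only
   on the values of f on U. *)
Fixpoint Ck_on (k : nat) (U : set 'rV[R]_7) (f : 'rV[R]_7 -> R^o) : Prop :=
  {in U, continuous f} /\
  (if k is j.+1 then
     forall i : 'I_7, (forall x, U x -> derivable f x (delta_mx 0 i)) /\
                      Ck_on j U ('D_(delta_mx 0 i) f)
   else True).

Definition smooth_on (U : set 'rV[R]_7) (f : 'rV[R]_7 -> R) : Prop :=
  forall k, Ck_on k U f.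

End Euclidean.

Record chart (R : realType) (M : topologicalType) := Chart {
  chart_dom : set M;
  chart_map : M -> 'rV[R]_7;
  chart_inv : 'rV[R]_7 -> M;
  chart_dom_open : open chart_dom;
  chart_img_open : open (chart_map @` chart_dom);
  chart_map_cont : {in chart_dom, continuous chart_map};
  chart_inv_cont : {in chart_map @` chart_dom, continuous chart_inv};
  chart_mapK : {in chart_dom, cancel chart_map chart_inv} }.

Definition chart_compatible (R : realType) (M : topologicalType)
    (c d : chart R M) : Prop :=
  forall i : 'I_7,
    smooth_on (chart_map c @` (chart_dom c `&` chart_dom d))
              (fun x => chart_map d (chart_inv c x) 0 i).

(* The smooth structure is the one generated by the atlas, which need not be
   maximal. *)
Record manifold7 (R : realType) := Manifold7 {
  mfd_top :> topologicalType;
  mfd_atlas : set (chart R mfd_top);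
  mfd_hausdorff : hausdorff_space mfd_top;
  mfd_second_countable : @second_countable mfd_top;
  mfd_cover : forall p : mfd_top, exists2 c, mfd_atlas c & chart_dom c p;
  mfd_compatible : forall c d,
    mfd_atlas c -> mfd_atlas d -> chart_compatible c d }.

Definition smooth_fun (R : realType) (M : manifold7 R) (f : M -> R) : Prop :=
  forall c, @mfd_atlas R M c ->
    smooth_on (chart_map c @` chart_dom c) (f \o chart_inv c).

Record Cinf (R : realType) (M : manifold7 R) := MkCinf {
  Cinf_fun :> M -> R;
  Cinf_smooth : smooth_fun Cinf_fun }.

Section Tangent.
Variables (R : realType) (M : manifold7 R) (p : M).

(* T_p M is the space of derivations at p of the algebra of smooth functions.
   Linearity and the Leibniz rule are stated for every h : Cinf M that is
   pointwise equal to a f + g, resp. to f g. *)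
Definition derivation_at : {pred (Cinf M -> R^o)} := fun D => `[<
  (forall (a : R) (f g h : Cinf M), (forall x, h x = a * f x + g x) ->
     D h = a * D f + D g) /\
  (forall f g h : Cinf M, (forall x, h x = f x * g x) ->
     D h = D f * g p + f p * D g) >].

Fact derivation_at_submod : submod_closed derivation_at.
Proof.
split.
  apply/asboolP; split=> [a f g h _|f g h _].
    by rewrite /GRing.zero /= mulr0 addr0.
  by rewrite /GRing.zero /= mul0r mulr0 addr0.
move=> b D E /asboolP[DL DM] /asboolP[EL EM]; apply/asboolP; split.
  move=> a f g h hE; have -> : (b *: D + E) h = b * D h + E h by [].
  have -> : (b *: D + E) f = b * D f + E f by [].
  have -> : (b *: D + E) g = b * D g + E g by [].
  by rewrite (DL _ _ _ _ hE) (EL _ _ _ _ hE) !mulrDr !mulrA (mulrC b a) addrACA.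
move=> f g h hE; have -> : (b *: D + E) h = b * D h + E h by [].
have -> : (b *: D + E) f = b * D f + E f by [].
have -> : (b *: D + E) g = b * D g + E g by [].
rewrite (DM _ _ _ hE) (EM _ _ _ hE) !mulrDr !mulrDl !mulrA.
by rewrite (mulrC (f p) b) addrACA.
Qed.

HB.instance Definition _ :=
  GRing.isSubmodClosed.Build R (Cinf M -> R^o) derivation_at
    derivation_at_submod.

Record tangent := Tangent {
  tangent_fun :> Cinf M -> R^o;
  tangent_derivation : tangent_fun \in derivation_at }.

HB.instance Definition _ := [isSub for tangent_fun].
HB.instance Definition _ := [Choice of tangent by <:].
HB.instance Definition _ := [SubChoice_isSubLmodule of tangent by <:].

End Tangent.

Section Forms.
Variables (R : realType) (W : lmodType R).

(* Not assumed multilinear or alternating: see [is_form]. *)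
Definition kform (k : nat) := ('I_k -> W) -> R.

Definition is_form k (a : kform k) : Prop :=
  (forall (v : 'I_k -> W) (i : 'I_k) (c : R) (x y : W),
     a (@dfwith _ _ v i (c *: x + y)) =
     c * a (@dfwith _ _ v i x) + a (@dfwith _ _ v i y)) /\
  (forall (v : 'I_k -> W) (i j : 'I_k), i != j -> v i = v j -> a v = 0).

Definition wedge k l (a : kform k) (b : kform l) : kform (k + l) := fun v =>
  (k`! * l`!)%:R^-1 *
  \sum_(s : 'S_(k + l)) (-1) ^+ s *
    a (fun i => v (s (lshift l i))) * b (fun j => v (s (rshift k j))).

Definition contraction k (u : W) (a : kform k.+1) : kform k := fun v =>
  a (fun i => oapp v u (unlift ord0 i)).

Definition is_inner (g : W -> W -> R) : Prop :=
  [/\ forall (c : R) (x y z : W), g (c *: x + y) z = c * g x z + g y z,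
      forall x y, g x y = g y x
    & forall x, x != 0 -> 0 < g x x].

Definition orthonormal_frame n (g : W -> W -> R) (e : 'I_n -> W) : Prop :=
  forall i j, g (e i) (e j) = (i == j)%:R.

Definition flat (g : W -> W -> R) (u : W) : kform 1 := fun v => g u (v ord0).

Definition form_inner n k (e : 'I_n -> W) (a b : kform k) : R :=
  (k`!)%:R^-1 *
  \sum_(I : {ffun 'I_k -> 'I_n}) a (fun i => e (I i)) * b (fun i => e (I i)).

(* b = *a, for W of dimension k + l: c /\ b = <c, a> vol for all k-forms c. *)
Definition is_star k l (g : W -> W -> R) (vol : kform (k + l))
    (a : kform k) (b : kform l) : Prop :=
  is_form b /\
  forall e : 'I_(k + l) -> W, orthonormal_frame g e ->
  forall c : kform k, is_form c ->
  forall v, wedge c b v = form_inner e c a * vol v.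

Definition star k l (g : W -> W -> R) (vol : kform (k + l))
    (a : kform k) : kform l :=
  xget (fun=> 0) [set b | is_star g vol a b].

End Forms.

Section Model.
Variable R : realType.

(* e^{m+1}, with m counted from 0. *)
Definition dual_basis (m : 'I_7) : kform 'rV[R]_7 1 := fun v => v ord0 0 m.

(* e^{ijk}, with indices counted from 1 as in the usual notation. *)
Definition e3 (i j k : nat) : kform 'rV[R]_7 3 :=
  wedge (wedge (dual_basis (inord i.-1)) (dual_basis (inord j.-1)))
        (dual_basis (inord k.-1)).

Definition phi0 : kform 'rV[R]_7 3 := fun v =>
  e3 1 2 3 v + e3 1 4 5 v + e3 1 6 7 v + e3 2 4 6 v
  - e3 2 5 7 v - e3 3 4 7 v - e3 3 5 6 v.

End Model.

Section Positive.
Variables (R : realType) (W : lmodType R).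

Definition positive_form (phi : kform W 3) : Prop :=
  exists2 L : {linear W -> 'rV[R]_7}, bijective L &
    forall v, phi v = phi0 (fun i => L (v i)).

(* No orientation is given: vol is one of the two volume forms of g, and the
   last equation selects it. *)
Definition is_metric_vol (phi : kform W 3)
    (gv : (W -> W -> R) * kform W 7) : Prop :=
  let: (g, vol) := gv in
  [/\ is_inner g,
      is_form vol,
      forall e : 'I_7 -> W, orthonormal_frame g e -> `|vol e| = 1
    & forall (u v : W) (x : 'I_7 -> W),
        g u v * vol x =
        6^-1 * wedge (wedge (contraction u phi) (contraction v phi)) phi x].

(* For a positive phi there is exactly one such pair. *)
Definition metric_vol (phi : kform W 3) : (W -> W -> R) * kform W 7 :=
  xget (fun _ _ => 0, fun=> 0) [set gv | is_metric_vol phi gv].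

Definition metric (phi : kform W 3) : W -> W -> R := (metric_vol phi).1.
Definition volume (phi : kform W 3) : kform W 7 := (metric_vol phi).2.

Definition psi_of (phi : kform W 3) : kform W 4 :=
  star (k := 3) (l := 4) (metric phi) (volume phi) phi.

Definition cross (phi : kform W 3) (a b : W) : W :=
  xget 0 [set w | forall c : W,
    metric phi w c = phi (fun i : 'I_3 => [:: a; b; c]`_i)].

Definition oct : Type := (R * W)%type.

Definition oct_of_im (u : W) : oct := (0, u).

Definition oct_conj (A : oct) : oct := (A.1, - A.2).

Definition oct_scale (c : R) (A : oct) : oct := (c * A.1, c *: A.2).

Variable phi : kform W 3.

Definition oct_inner (A B : oct) : R := A.1 * B.1 + metric phi A.2 B.2.

Definition oct_mul (A B : oct) : oct :=
  (A.1 * B.1 - metric phi A.2 B.2,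
   A.1 *: B.2 + B.1 *: A.2 + cross phi A.2 B.2).

Definition oct_inv (A : oct) : oct := oct_scale (oct_inner A A)^-1 (oct_conj A).

Definition oct_cube (A : oct) : oct := oct_mul (oct_mul A A) A.

Definition oct_Ad (A B : oct) : oct := oct_mul (oct_mul A B) (oct_inv A).

(* Ad_A maps imaginary octonions to imaginary ones, so that only the imaginary
   component is kept. *)
Definition oct_Ad_im (A : oct) (u : W) : W := (oct_Ad A (oct_of_im u)).2.

Definition sigma (A : oct) : kform W 3 := fun v =>
  (oct_inner A A)^-1 *
  ((A.1 ^+ 2 - metric phi A.2 A.2) * phi v
   - 2 * A.1 * contraction A.2 (psi_of phi) v
   + 2 * wedge (flat (metric phi) A.2) (contraction A.2 phi) v).

End Positive.

Section G2.
Variables (R : realType) (M : manifold7 R).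

Definition smooth_vf (X : forall p : M, tangent p) : Prop :=
  forall f : Cinf M, smooth_fun (fun p => X p f).

(* A k-form is smooth iff it takes smooth values on smooth vector fields. *)
Definition smooth_form k (phi : forall p : M, kform (tangent p) k) : Prop :=
  forall X : 'I_k -> forall p : M, tangent p, (forall i, smooth_vf (X i)) ->
    smooth_fun (fun p => phi p (fun i => X i p)).

Definition G2_structure (phi : forall p : M, kform (tangent p) 3) : Prop :=
  [/\ forall p, is_form (phi p), smooth_form phi
    & forall p, positive_form (phi p)].

Definition oct_section (V : forall p : M, oct (tangent p)) : Prop :=
  smooth_fun (fun p => (V p).1) /\ smooth_vf (fun p => (V p).2).

Definition nowhere_vanishing (V : forall p : M, oct (tangent p)) : Prop :=
  forall p, V p <> (0, 0).

End G2.

(* Main.v *)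
(* The statement is pointwise.  A linear isomorphism carries phi_p to the model
   form phi0, and the metric, the volume form and *phi are determined by the
   equations that define them, so that they can be checked against explicit
   candidates: the Euclidean product, the determinant, and the 4-form
     psi(x,y,z,w) = <x X y, z X w> - <x,z><y,w> + <x,w><y,z>.
   With V = (a, b) and N = |b|^2 one finds V^3 = (a^3 - 3aN, (3a^2 - N) b) and
     (a^2 + N) Ad_(V^-1) u = (a^2 - N) u + 2 <b,u> b - 2a b X u.
   Expanding phi trilinearly, every product b X u is eliminated by the formula
   for psi, by b X (b X u) = <b,u> b - N u, and by
     phi(b X x, b X y, z) = - N phi(x,y,z) + <b,x> phi(b,y,z)
                            - <b,y> phi(b,x,z) + 2 <b,z> phi(b,x,y). *)
Require Import Defs.
From mathcomp Require Import all_boot all_order all_algebra.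
From mathcomp Require Import all_fingroup ring lra zify.
From mathcomp Require Import all_classical all_reals all_analysis.

Set Implicit Arguments.
Unset Strict Implicit.
Unset Printing Implicit Defensive.

Import Order.TTheory GRing.Theory Num.Theory.

Local Open Scope ring_scope.

(** * Sums over permutations reduced to sums over shuffles *)

Section Shuffles.
Variables (R : numFieldType) (T : Type).
Implicit Types (a b : seq T -> R) (s t : seq T) (x y : T).

Definition alternating k a : Prop := forall s t x y,
  (size s + size t).+2 = k -> a (s ++ x :: y :: t) = - a (s ++ y :: x :: t).

(* Laplace expansion: the sum over the (k, l)-shuffles, generated by deciding
   whether the first vector goes to a or to b. *)
Fixpoint shuffle_prod k l a b s : R :=
  if s is x :: s' then
    (if k is k'.+1 then shuffle_prod k' l (fun t => a (x :: t)) b s' else 0) +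
    (if l is l'.+1 then
       (-1) ^+ k * shuffle_prod k l' a (fun t => b (x :: t)) s' else 0)
  else a [::] * b [::].

Definition insert j x s := take j s ++ x :: drop j s.

Lemma alternating_cons k a x :
  alternating k.+1 a -> alternating k (fun t => a (x :: t)).
Proof. by move=> aA s t y z st; rewrite -!cat_cons aA //= addSn st. Qed.

(** Moving x from position j to the front takes j adjacent transpositions. *)
Lemma alternating_insert k a j x s : alternating k a ->
  (size s).+1 = k -> (j <= size s)%N -> a (insert j x s) =
    (-1) ^+ j * a (x :: s).
Proof.
rewrite /insert; elim: j k a s => [|j IH] k a s aA sk.
  by rewrite take0 drop0 mul1r.
case: s sk => // y s sk; rewrite ltnS => js /=.
case: k aA sk => // k aA [sk].
rewrite (IH k (fun t => a (y :: t))) // ?exprS; last exact: alternating_cons.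
by rewrite -[y :: _]cat0s (aA [::] s) ?mulN1r ?mulrN ?mulNr //= add0n sk.
Qed.

(** A permutation is encoded by the index j that it sends to [ord0] and by a permutation of the
    remaining indices; this encoding is injective and the cardinalities agree. *)
Lemma sum_perm_lift n (F : 'S_n.+1 -> R) :
  \sum_s F s = \sum_j \sum_(t : 'S_n) F (lift_perm j ord0 t).
Proof.
rewrite pair_bigA /= (reindex (fun p :
  'I_n.+1 * 'S_n => lift_perm p.1 ord0 p.2)) //.
apply: onW_bij; apply: inj_card_bij;
  last by rewrite card_prod card_ord !card_Sn factS.
move=> [j t] [j' t'] /= jt; have jj' : j = j'.
  have := lift_perm_id j ord0 t; rewrite jt.
  case: (unliftP j' j) => [k ->|-> //].
  by rewrite lift_perm_lift => /eqP; rewrite eq_sym (negbTE (neq_lift _ _)).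
rewrite -jj' in jt *; congr (_, _); apply/permP => k.
by apply: (@lift_inj _ ord0); rewrite -!(lift_perm_lift j) jt.
Qed.

Lemma map_lift_perm n (v : 'I_n.+1 -> T) j (t : 'S_n) :
  [seq v (lift_perm j ord0 t i) | i <- enum 'I_n.+1] =
  insert j (v ord0) [seq v (lift ord0 (t i)) | i <- enum 'I_n].
Proof.
have sz : size [seq v (lift ord0 (t i)) | i <- enum 'I_n] = n.
  by rewrite size_map size_enum_ord.
have jn : (j <= n)%N by rewrite -ltnS.
apply: (@eq_from_nth _ (v ord0)) => [|i].
  rewrite /insert size_cat /= size_takel ?sz // size_drop sz size_map
    size_enum_ord.
  by rewrite addnS subnKC.
rewrite size_map size_enum_ord => iln; pose io := Ordinal iln.
rewrite (nth_map ord0) ?size_enum_ord // (nth_ord_enum ord0 io).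
rewrite /insert nth_cat size_takel ?sz //.
case: (unliftP j io) => [k ek|ek].
  rewrite ek lift_perm_lift.
  have -> : i = bump j k by rewrite -[i]/(val io) ek.
  have vk : v (lift ord0 (t k)) =
      nth (v ord0) [seq v (lift ord0 (t i)) | i <- enum 'I_n] k.
    by rewrite (nth_map k) ?size_enum_ord // nth_ord_enum.
  rewrite vk /bump; case: (leqP j k) => jk /=.
    rewrite add1n ltnNge (leqW jk) /= subSn //= nth_drop subnKC //.
  by rewrite add0n jk nth_take.
by rewrite ek lift_perm_id -[i]/(val io) ek ltnn subnn.
Qed.

(** Induction on n, splitting by the position j of the first vector. If j < k, it is an argument of
    a, and bringing it to the front costs (-1)^j, which cancels the sign contributed by j. Otherwise
    it is an argument of b, and (-1)^k remains. There are k equal terms of the first kind and l of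
    the second, which turn (k-1)! l! and k! (l-1)! into k! l!. *)
Lemma sum_perm_shuffle n k l a b (v : 'I_n -> T) :
  n = (k + l)%N -> alternating k a -> alternating l b ->
  \sum_(s : 'S_n) (-1) ^+ s * a (take k [seq v (s i) | i <- enum 'I_n])
                            * b (drop k [seq v (s i) | i <- enum 'I_n])
  = (k`! * l`!)%:R * shuffle_prod k l a b [seq v i | i <- enum 'I_n].
Proof.
elim: n k l a b v => [|n IH] k l a b v nkl aA bA.
  have [-> ->] : k = 0%N /\ l = 0%N by lia.
  have e0 : enum 'I_0 = [::] by apply: size0nil; rewrite size_enum_ord.
  rewrite (bigD1 1%g) //= big1 => [|s /eqP[]]; last by apply/permP => -[].
  by rewrite e0 /= odd_perm1 fact0 !mul1r addr0.
rewrite sum_perm_lift [in RHS]enum_ordSl /=.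
set L := fun r : 'S_n => [seq v (lift ord0 (r i)) | i <- enum 'I_n].
have szL r : size (L r) = n by rewrite size_map size_enum_ord.
pose x := v ord0.
have signE (j : 'I_n.+1) (r : 'S_n) :
    (-1) ^+ lift_perm j ord0 r = (-1) ^+ j * (-1) ^+ r :> R.
  by rewrite odd_lift_perm /= addbF signr_addb signr_odd.
(* The common contribution of all positions j < k, taken at k' = k - 1. For k = 0 there is no such
   position, so the truncated predecessor is harmless. *)
pose A k' := \sum_(r :
  'S_n) (-1) ^+ r * a (x :: take k' (L r)) * b (drop k' (L r)).
pose B := \sum_(r : 'S_n) (-1) ^+ r * a (take k (L r)) * b (x :: drop k (L r)).
have termE (j : 'I_n.+1) : \sum_(r : 'S_n) (-1) ^+ lift_perm j ord0 r *
    a (take k [seq v (lift_perm j ord0 r i) | i <- enum 'I_n.+1]) *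
    b (drop k [seq v (lift_perm j ord0 r i) | i <- enum 'I_n.+1]) =
    if (j < k)%N then A k.-1 else (-1) ^+ k * B.
  have jn : (j <= n)%N by rewrite -ltnS.
  have szj r : size (take j (L r)) = j by rewrite size_takel ?szL.
  case: ifP => jk; rewrite ?mulr_sumr; apply: eq_bigr => r _.
    rewrite map_lift_perm -/x -/(L r) signE.
    have kj : (k - j)%N = (k.-1 - j).+1 by lia.
    have -> : take k (insert j x (L r)) = insert j x (take k.-1 (L r)).
      rewrite /insert take_cat szj ltnNge (ltnW jk) /= kj /= take_takel;
        last by lia.
      by rewrite take_drop subnK //; lia.
    have -> : drop k (insert j x (L r)) = drop k.-1 (L r).
      rewrite /insert drop_cat szj ltnNge (ltnW jk) /= kj.
      by rewrite /= drop_drop subnK //; lia.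
    rewrite (alternating_insert _ aA) ?size_takel ?szL; try lia.
    by rewrite mulrACA -expr2 sqrr_sign mul1r.
  rewrite map_lift_perm -/x -/(L r) signE.
  move/negbT: jk; rewrite -leqNgt => kj.
  have -> : take k (insert j x (L r)) = take k (L r).
    rewrite /insert take_cat szj; case: ltngtP kj => // [jk|->] _;
      first by rewrite take_takel // ltnW.
    by rewrite subnn take0 cats0.
  have -> : drop k (insert j x (L r)) = insert (j - k) x (drop k (L r)).
    rewrite /insert drop_cat szj; case: ltngtP kj => // [kj|->] _.
      by rewrite drop_drop subnK 1?ltnW // take_drop subnK // ltnW.
    by rewrite subnn drop0 take0 drop0.
  rewrite (alternating_insert _ bA) ?size_drop ?szL; try lia.
  have -> : (-1) ^+ j = (-1) ^+ k * (-1) ^+ (j - k) :> R by rewrite -exprD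
    subnKC.
  have := sqrr_sign R (j - k); rewrite expr2.
  by move: ((-1) ^+ (j - k)) ((-1) ^+ k) ((-1) ^+ r) (a _) (b _) => e f g a' b'
    ee;
    rewrite -[RHS]mul1r -ee; ring.
under eq_bigr => j _ do rewrite termE.
rewrite (bigID (fun j : 'I_n.+1 => (j < k)%N)) /=.
under eq_bigr => j jk do rewrite jk.
under [X in _ + X]eq_bigr => j jk do rewrite (negbTE jk).
rewrite !sumr_const.
have cardk : #|[pred j : 'I_n.+1 | (j < k)%N]| = k.
  have kn : (k <= n.+1)%N by rewrite nkl leq_addr.
  by rewrite -sum1_card -(big_ord_widen n.+1 (fun=> 1%N) kn) sum1_card card_ord.
have cardl : #|[pred j : 'I_n.+1 | ~~ (j < k)%N]| = l.
  apply: (@addnI k); rewrite -[in LHS]cardk -nkl -[RHS]card_ord.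
  rewrite -(cardC [pred j : 'I_n.+1 | (j < k)%N]); apply: congr1.
  by apply: eq_card => i; rewrite !inE cardk.
rewrite cardk cardl mulrDr -map_comp; congr (_ + _).
  case: k {B termE cardk cardl} nkl aA => [|k] nkl aA;
    first by rewrite mulr0n mulr0.
  have := IH k l _ b (fun i => v (lift ord0 i)) _ (@alternating_cons k a x aA)
    bA.
  rewrite /A /= => ->; last by case: nkl.
  by rewrite -[LHS]mulr_natl mulrA -natrM mulnA -factS.
case: l {A termE cardk cardl} nkl bA => [|l] nkl bA;
  first by rewrite mulr0n mulr0.
have := IH k l a _ (fun i => v (lift ord0 i)) _ aA (@alternating_cons l b x bA).
rewrite /B /= => ->; last by move: nkl; rewrite addnS => -[].
by rewrite -[_ *+ l.+1]mulr_natl factS !natrM; ring.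
Qed.
End Shuffles.

(** * Alternating forms and their wedge products *)

Section FormTheory.
Variables (R : realType) (W : lmodType R).
Implicit Types (k l : nat).

Definition multilinear k (a : kform W k) : Prop :=
  forall (v : 'I_k -> W) (i : 'I_k) (c : R) (x y : W),
     a (@dfwith _ _ v i (c *: x + y)) =
     c * a (@dfwith _ _ v i x) + a (@dfwith _ _ v i y).

Lemma multilinear0 k (a : kform W k) v i :
  multilinear a -> a (@dfwith _ _ v i 0) = 0.
Proof.
move=> aL; have := aL v i 1 0 0; rewrite scale1r addr0 mul1r.
by move/eqP; rewrite -subr_eq0 opprD addrA subrr add0r oppr_eq0 => /eqP.
Qed.

Lemma multilinear_sum k (a : kform W k) v i (I : finType) (c : I -> R) (x :
  I -> W) :
  multilinear a -> a (@dfwith _ _ v i (\sum_j c j *: x j)) =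
                   \sum_j c j * a (@dfwith _ _ v i (x j)).
Proof.
move=> aL; elim/big_rec2: _ => [|j u w _ <-]; first exact: multilinear0.
exact: aL.
Qed.

Lemma dfwith_id k (v : 'I_k -> W) i : @dfwith _ _ v i (v i) = v.
Proof. by apply/funext => j; case: dfwithP. Qed.

Lemma dfwithC k (v : 'I_k -> W) i j x y : i != j ->
  @dfwith _ _ (@dfwith _ _ v i x) j y = @dfwith _ _ (@dfwith _ _ v j y) i x.
Proof.
move=> ij; apply/funext => m.
have [<-|jm] := eqVneq j m; first by rewrite dfwithin dfwithout // dfwithin.
rewrite dfwithout //; have [<-|im] := eqVneq i m; first by rewrite !dfwithin.
by rewrite !dfwithout.
Qed.

(** With [w x y] carrying x in slot i and y in slot j, the value of a on [w (v i + v j) (v i + v j)]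
    is 0, and its expansion leaves only the two mixed terms. *)
Lemma form_tperm k (a : kform W k) v i j :
  is_form a -> i != j -> a (v \o tperm i j) = - a v.
Proof.
move=> [aL aA] ij.
pose w x y := @dfwith _ _ (@dfwith _ _ v i x) j y.
have wxx x : a (w x x) = 0.
  by apply: (aA _ i j ij); rewrite /w dfwithin dfwithout 1?eq_sym // dfwithin.
have wr x y y' : a (w x (y + y')) = a (w x y) + a (w x y').
  by have := aL (@dfwith _ _ v i x) j 1 y y'; rewrite scale1r mul1r.
have wl x x' y : a (w (x + x') y) = a (w x y) + a (w x' y).
  rewrite /w !(dfwithC _ _ _ ij).
  by have := aL (@dfwith _ _ v j y) i 1 x x'; rewrite scale1r mul1r.
have -> : v \o tperm i j = w (v j) (v i).
  apply/funext => m /=; rewrite /w.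
  case: tpermP => [->|->|/eqP mi /eqP mj].
  - by rewrite dfwithout 1?eq_sym // dfwithin.
  - by rewrite dfwithin.
  - by rewrite !dfwithout // eq_sym.
have -> : a v = a (w (v i) (v j)) by rewrite /w dfwith_id // dfwith_id.
apply/eqP; rewrite -addr_eq0; apply/eqP.
by have := wxx (v i + v j); rewrite wl !wr !wxx add0r addr0 addrC.
Qed.

Lemma form_perm k (a : kform W k) v (s : 'S_k) :
  is_form a -> a (v \o s) = (-1) ^+ s * a v.
Proof.
move=> aF; have [ts -> _] := prod_tpermP s.
elim: ts v => [|t ts IH] v.
  rewrite big_nil odd_perm1 mul1r; congr a.
  by apply/funext => i /=; rewrite perm1.
rewrite big_cons /=.
set u := (\prod_(_ <- _) _)%g.
have -> : v \o (tperm t.1 t.2 * u)%g = (v \o u) \o tperm t.1 t.2.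
  by apply/funext => i /=; rewrite permM.
rewrite odd_permM signr_addb odd_tperm.
(* The decomposition is used without the distinctness of each pair, so a trivial transposition is
   treated as well. *)
have [->|t12] := eqVneq t.1 t.2.
  rewrite mul1r -IH; congr a; apply/funext => i /=.
  by rewrite tperm1 perm1.
by rewrite form_tperm // IH mulN1r mulNr.
Qed.

(** Lists let [shuffle_prod] supply the arguments one at a time; missing arguments are read as the
    zero vector. *)
Definition on_seq k (a : kform W k) : seq W -> R :=
  fun s => a (fun i => nth 0 s i).

Lemma form_alternating k (a : kform W k) : is_form a ->
  alternating k (on_seq a).
Proof.
move=> aF s t x y st; rewrite /on_seq.
have ik : (size s < k)%N by rewrite -st; lia.
have jk : ((size s).+1 < k)%N by rewrite -st; lia.
have ij : Ordinal ik != Ordinal jk by rewrite -val_eqE /=; lia.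
rewrite -(form_tperm _ aF ij); congr a; apply/funext => m /=.
rewrite !nth_cat; case: tpermP => [->|->|] /=.
- by rewrite ltnn subnn ltnNge leqnSn subSn // subnn.
- by rewrite ltnn subnn ltnNge leqnSn subSn // subnn.
move=> /eqP; rewrite -val_eqE /= => ms /eqP; rewrite -val_eqE /= => ms'.
case: ltnP => // sm.
by have -> : (m - size s)%N = (m - size s).-2.+2 by lia.
Qed.

(** Each shuffle stands for the k! l! permutations obtained by reordering inside its two blocks,
    which is the normalizing factor of [wedge]. *)
Lemma wedge_shuffle k l (a : kform W k) (b : kform W l) v :
  is_form a -> is_form b ->
  wedge a b v =
  shuffle_prod k l (on_seq a) (on_seq b) [seq v i | i <- enum 'I_(k + l)].
Proof.
move=> aF bF; apply: (mulfI (_ : (k`! * l`!)%:R != 0)).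
  by rewrite pnatr_eq0 -lt0n muln_gt0 !fact_gt0.
rewrite mulrA mulfV ?mul1r; last by rewrite pnatr_eq0 -lt0n muln_gt0 !fact_gt0.
rewrite -sum_perm_shuffle //; try exact: form_alternating.
apply: eq_bigr => s _; rewrite /on_seq; congr (_ * a _ * b _).
  apply/funext => i; rewrite nth_take // (nth_map (lshift l i)) ?size_enum_ord.
    by rewrite (nth_ord_enum _ (lshift l i)).
  by rewrite (leq_trans (ltn_ord i)) // leq_addr.
apply/funext => i; rewrite nth_drop (nth_map (rshift k i)) ?size_enum_ord.
  by rewrite (nth_ord_enum _ (rshift k i)).
by rewrite ltn_add2l.
Qed.

Lemma is_formD k (a b : kform W k) :
  is_form a -> is_form b -> is_form (fun v => a v + b v).
Proof.
move=> [aL aA] [bL bA]; split=> [v i c x y|v i j ij vij].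
  by rewrite aL bL mulrDr addrACA.
by rewrite (aA v i j) // (bA v i j) // addr0.
Qed.

Lemma is_formZ k (a : kform W k) (c : R) :
  is_form a -> is_form (fun v => c * a v).
Proof.
move=> [aL aA]; split=> [v i d x y|v i j ij vij].
  by rewrite aL mulrDr mulrCA.
by rewrite (aA v i j) // mulr0.
Qed.

Lemma is_formB k (a b : kform W k) :
  is_form a -> is_form b -> is_form (fun v => a v - b v).
Proof.
move=> aF bF; have := is_formD aF (is_formZ (-1) bF).
by congr is_form; apply/funext => v; rewrite mulN1r.
Qed.

Lemma wedge_form k l (a : kform W k) (b : kform W l) :
  is_form a -> is_form b -> is_form (wedge a b).
Proof.
move=> aF bF; apply: is_formZ; split=> [v i c x y|v i j ij vij].
  rewrite mulr_sumr -big_split /=; apply: eq_bigr => s _.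
  have out z m : s m != i -> @dfwith _ _ v i z (s m) = v (s m).
    by move=> sm; rewrite dfwithout // eq_sym.
  (* Slot i feeds a or b according to the block containing its preimage under s, and only that
     factor depends on the vector placed there. *)
  case: (splitP (s^-1%g i)) => [m|m] im.
    have sm : s (lshift l m) = i.
      by rewrite -[RHS](permKV s); congr (s _); apply: val_inj; rewrite /= im.
    have aE z : a (fun n => @dfwith _ _ v i z (s (lshift l n))) =
        a (@dfwith _ _ (fun n => v (s (lshift l n))) m z).
      congr a; apply/funext => n; have [<-|mn] := eqVneq m n.
        by rewrite dfwithin sm dfwithin.
      rewrite [RHS]dfwithout // out // -sm (inj_eq perm_inj) eq_sym.
      by rewrite (inj_eq (@lshift_inj _ _)).
    have bE z : b (fun n => @dfwith _ _ v i z (s (rshift k n))) =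
        b (fun n => v (s (rshift k n))).
      congr b; apply/funext => n; rewrite out // -sm (inj_eq perm_inj).
      by rewrite eq_sym eq_lrshift.
    by rewrite !aE !bE (proj1 aF); move: ((-1) ^+ s) => e; ring.
  have sm : s (rshift k m) = i.
    by rewrite -[RHS](permKV s); congr (s _); apply: val_inj; rewrite /= im.
  have bE z : b (fun n => @dfwith _ _ v i z (s (rshift k n))) =
      b (@dfwith _ _ (fun n => v (s (rshift k n))) m z).
    congr b; apply/funext => n; have [<-|mn] := eqVneq m n.
      by rewrite dfwithin sm dfwithin.
    rewrite [RHS]dfwithout // out // -sm (inj_eq perm_inj) eq_sym.
    by rewrite (inj_eq (@rshift_inj _ _)).
  have aE z : a (fun n => @dfwith _ _ v i z (s (lshift l n))) =
      a (fun n => v (s (lshift l n))).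
    congr a; apply/funext => n; rewrite out // -sm (inj_eq perm_inj).
    by rewrite eq_lrshift.
  by rewrite !aE !bE (proj1 bF); move: ((-1) ^+ s) => e; ring.
pose t := fun s : 'S_(k + l) => (s * tperm i j)%g.
set S := (X in X = 0).
(* Composing s with the transposition of i and j flips its sign and keeps the arguments, since v i =
   v j; so the sum is its own opposite. *)
have SN : S = - S.
  rewrite /S [LHS](reindex_inj (mulIg (tperm i j))) /= -sumrN.
  apply: eq_bigr => s _;
    rewrite odd_permM odd_tperm ij signr_addb expr1 mulrN1 !mulNr.
  have vt m : v (tperm i j m) = v m by case: tpermP => [->|->|].
  by congr (- (_ * a _ * b _)); apply/funext => m; rewrite permM vt.
apply/eqP; have : S *+ 2 == 0 by rewrite mulr2n {1}SN addNr.
by rewrite mulrn_eq0.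
Qed.

End FormTheory.

(** * Pullback of forms along linear maps *)

Section Pullback.
Variables (R : realType) (W X : lmodType R) (L : W -> X).

Lemma dfwith_comp k (v : 'I_k -> W) i x :
  (fun j => L (@dfwith _ _ v i x j)) = @dfwith _ _ (fun j => L (v j)) i (L x).
Proof.
by apply/funext => j; have [<-|ij] := eqVneq i j;
  rewrite ?dfwithin // !dfwithout.
Qed.

Lemma pullback_form k (a : kform X k) :
  linear L -> is_form a -> is_form (fun v : 'I_k -> W => a (fun i => L (v i))).
Proof.
move=> Llin [aL aA]; split=> [v i c x y|v i j ij vij].
  by rewrite !dfwith_comp Llin aL.
by apply: (aA _ i j ij); rewrite vij.
Qed.

Lemma pullback_contraction k (a : kform X k.+1) u (v : 'I_k -> W) :
  Defs.contraction u (fun w : 'I_k.+1 -> W => a (fun i => L (w i))) v =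
  Defs.contraction (L u) a (fun i => L (v i)).
Proof.
by rewrite /Defs.contraction; congr a; apply/funext => i; case: (unlift ord0 i).
Qed.

End Pullback.

(** * Forms on coordinate space: basis expansion, determinant, orthonormal frames *)

Section Coordinates.
Variables (R : realType) (n : nat).
Local Notation V := 'rV[R]_n.
Local Notation std := (fun i : 'I_n => delta_mx 0 i : V).

(** The slots are expanded in the standard basis one by one: [a_std] inducts on the number m of
    leading slots that may still hold arbitrary vectors. *)
Lemma multilinear_eq0 k (a : kform V k) : multilinear a ->
  (forall J : 'I_k -> 'I_n, a (std \o J) = 0) -> forall v, a v = 0.
Proof.
move=> aL a0 v.
have a_std m w : (forall i : 'I_k, (m <= i)%N -> exists j, w i = std j) ->
  a w = 0.
  elim: m w => [|m IH] w wE.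
    have [J JE] := choice (fun i => wE i isT).
    by rewrite -(a0 J); congr a; apply/funext => i; rewrite JE.
  have [mk|km] := ltnP m k; last first.
    by apply: IH => i mi; have := leq_trans km mi; rewrite leqNgt ltn_ord.
  rewrite -(dfwith_id w (Ordinal mk)) (row_sum_delta (w _)) multilinear_sum //.
  apply: big1 => j _; rewrite IH ?mulr0 // => i mi.
  have [<-|im] := eqVneq (Ordinal mk) i; first by exists j; rewrite dfwithin.
  rewrite dfwithout //; apply: wE; rewrite ltn_neqAle mi andbT.
  by move: im; rewrite -val_eqE.
by apply: (a_std k) => i; rewrite leqNgt ltn_ord.
Qed.

(** The difference of the two sides is multilinear, so basis tuples suffice, and there only the
    index map of the tuple itself contributes. *)
Lemma multilinear_expand k (a : kform V k) v : multilinear a ->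
  a v = \sum_(J : {ffun 'I_k -> 'I_n}) (\prod_i v i 0 (J i)) * a (std \o J).
Proof.
move=> aL; apply/eqP; rewrite -subr_eq0; apply/eqP; move: v.
apply: multilinear_eq0 => [v i c x y|J].
  rewrite aL mulrBr [RHS]addrACA -opprD; congr (_ - _).
  rewrite mulr_sumr -big_split /=; apply: eq_bigr => J _.
  have pE z : \prod_j @dfwith _ _ v i z j 0 (J j) =
      z 0 (J i) * \prod_(j | j != i) v j 0 (J j).
    rewrite (bigD1 i) //= dfwithin; congr (_ * _).
    by apply: eq_bigr => j ji; rewrite dfwithout // eq_sym.
  by rewrite !pE !mxE; ring.
rewrite (bigD1 [ffun i => J i]) //= [X in _ * X + _](_ : _ = a (std \o J)).
  rewrite big1 => [|i _]; last by rewrite ffunE mxE !eqxx.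
  rewrite mul1r big1 ?addr0 ?subrr // => K KJ.
  have [i Ki] : exists i, K i != J i.
    apply/existsP; apply: contraR KJ; rewrite negb_exists => /forallP KJ.
    by apply/eqP/ffunP => i; rewrite ffunE; have := KJ i; rewrite negbK => /eqP.
  by rewrite (bigD1 i) //= mxE (negbTE Ki) andbF !mul0r.
by congr a; apply/funext => i; rewrite /= ffunE.
Qed.

(** On basis tuples, an injective index map permutes the standard basis and changes h at most by a
    sign, while a non-injective one repeats a vector. *)
Lemma top_form_eq0 (h : kform V n) : is_form h -> h std = 0 -> forall v, h v =
  0.
Proof.
move=> hF h0; apply: multilinear_eq0 => [|J]; first by case: hF.
have [/injectiveP Jinj|/injectivePn[i [j ij Jij]]] := boolP (injectiveb J).
  have -> : std \o J = std \o perm Jinj by apply/funext => i /=; rewrite permE.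
  by rewrite form_perm // h0 mulr0.
by apply: (proj2 hF _ i j ij); rewrite /= Jij.
Qed.

Lemma det_form : is_form (fun v : 'I_n -> V => \det (\matrix_i v i)).
Proof.
split=> [v i c x y|v i j ij vij].
  rewrite (determinant_multilinear (i0 := i) (b := c) (c := 1)
    (B := \matrix_j @dfwith _ _ v i x j) (C := \matrix_j @dfwith _ _ v i y j)).
  - by rewrite mul1r.
  - by rewrite !rowK !dfwithin scale1r.
  - by apply/matrixP => j k; rewrite !mxE !dfwithout // neq_lift.
  - by apply/matrixP => j k; rewrite !mxE !dfwithout // neq_lift.
by rewrite (determinant_alternate ij) // => k; rewrite !mxE vij.
Qed.

Lemma top_form_det (h : kform V n) v :
  is_form h -> h v = h std * \det (\matrix_i v i).
Proof.
move=> hF; apply/eqP; rewrite -subr_eq0; apply/eqP; move: v.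
apply: top_form_eq0; first exact: is_formB hF (is_formZ _ det_form).
have -> : \matrix_i std i = 1%:M :> 'M[R]_n.
  by apply/matrixP => i j; rewrite !mxE eqxx eq_sym.
by rewrite det1 mulr1 subrr.
Qed.

Definition dot (x y : V) : R := \sum_i x 0 i * y 0 i.

Lemma orthonormal_mul (e : 'I_n -> V) : orthonormal_frame dot e ->
  (\matrix_i e i) *m (\matrix_i e i)^T = 1%:M.
Proof.
move=> eo; apply/matrixP => i j; rewrite !mxE -(eo i j).
by apply: eq_bigr => m _; rewrite !mxE.
Qed.

Lemma orthonormal_det (e : 'I_n -> V) :
  orthonormal_frame dot e -> `|\det (\matrix_i e i)| = 1.
Proof.
move=> /orthonormal_mul /(congr1 determinant).
rewrite det_mulmx det_tr det1 => dd; apply/eqP.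
by rewrite -(@pexpr_eq1 _ _ 2) // -normrX expr2 dd normr1.
Qed.

(** Once a and b are expanded in the standard basis, the sum over index maps factors slot by slot
    into entries of E^T E = 1, with E the matrix of the frame; only pairs of equal index maps
    survive. *)
Lemma form_inner_orthonormal k (a b : kform V k) (e : 'I_n -> V) :
  multilinear a -> multilinear b -> orthonormal_frame dot e ->
  form_inner e a b = form_inner std a b.
Proof.
move=> aL bL eo; congr (_ * _).
(* Orthonormal rows force orthonormal columns, a right inverse of a square matrix being a left
   inverse. *)
have ete (j m : 'I_n) : \sum_i e i 0 j * e i 0 m = (j == m)%:R.
  have /(congr1 (fun A : 'M[R]_n => A j m)) := mulmx1C (orthonormal_mul eo).
  by rewrite !mxE => <-; apply: eq_bigr => i _; rewrite !mxE.
under eq_bigr => I _.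
  rewrite (multilinear_expand (fun i => e (I i)) aL).
  rewrite (multilinear_expand (fun i => e (I i)) bL) big_distrl /=.
  under eq_bigr => J _ do rewrite big_distrr /=.
  over.
rewrite exchange_big; apply: eq_bigr => J _ /=.
rewrite exchange_big (bigD1 J) //= [X in _ + X]big1 => [|K KJ].
  under eq_bigr => I _ do rewrite mulrACA -big_split /=.
  rewrite -mulr_suml addr0.
  rewrite -(bigA_distr_bigA (fun i j => e j 0 (J i) * e j 0 (J i))) /=.
  by rewrite big1 ?mul1r // => i _; rewrite ete eqxx.
under eq_bigr => I _ do rewrite mulrACA -big_split /=.
rewrite -mulr_suml -(bigA_distr_bigA (fun i j => e j 0 (J i) * e j 0 (K i))) /=.
have [i Ki] : exists i, J i != K i.
  apply/existsP; apply: contraR KJ; rewrite negb_exists => /forallP JK.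
  by apply/eqP/ffunP => i; have := JK i; rewrite negbK => /eqP.
by rewrite (bigD1 i) //= ete (negbTE Ki) !mul0r.
Qed.

End Coordinates.

(** * Contractions, and forms evaluated on lists *)

Section Contraction.
Variables (R : realType) (W : lmodType R).

Lemma contraction_form k (u : W) (a : kform W k.+1) :
  is_form a -> is_form (Defs.contraction u a).
Proof.
move=> [aL aA]; split=> [v i c x y|v i j ij vij].
  have cE z : Defs.contraction u a (@dfwith _ _ v i z) =
      a (@dfwith _ _ (fun j => oapp v u (unlift ord0 j)) (lift ord0 i) z).
    rewrite /Defs.contraction; congr a; apply/funext => m.
    case: (unliftP ord0 m) => [m'|] -> /=;
      last by rewrite dfwithout // unlift_none.
    have [<-|im] := eqVneq i m'; first by rewrite !dfwithin.
    by rewrite !dfwithout ?(inj_eq lift_inj) // liftK.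
  by rewrite !cE aL.
apply: (aA _ (lift ord0 i) (lift ord0 j)); first by rewrite (inj_eq lift_inj).
by rewrite !liftK.
Qed.

Lemma on_seq_contraction k (u : W) (a : kform W k.+1) s :
  on_seq (Defs.contraction u a) s = on_seq a (u :: s).
Proof.
rewrite /on_seq /Defs.contraction; congr a; apply/funext => i.
by case: (unliftP ord0 i) => [j|] ->.
Qed.

Lemma on_seq_enum k (a : kform W k) v : a v =
  on_seq a [seq v i | i <- enum 'I_k].
Proof.
congr a; apply/funext => i.
by rewrite (nth_map i) ?size_enum_ord // nth_ord_enum.
Qed.

Lemma map_nth_enum n (s : seq W) : size s = n ->
  [seq s`_(val i) | i <- enum 'I_n] = s.
Proof.
move=> sn; apply: (@eq_from_nth _ 0) => [|i];
  rewrite size_map size_enum_ord ?sn //.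
move=> iln; rewrite (nth_map (Ordinal iln)) ?size_enum_ord //.
by rewrite (nth_ord_enum _ (Ordinal iln)).
Qed.

Lemma on_seq_wedge k l (a : kform W k) (b : kform W l) s :
  is_form a -> is_form b -> size s = (k + l)%N ->
  on_seq (wedge a b) s = shuffle_prod k l (on_seq a) (on_seq b) s.
Proof. by move=> aF bF ss; rewrite /on_seq wedge_shuffle // map_nth_enum. Qed.

End Contraction.

(** * The model on R^7: cross product and identities for [phi0] *)

Section Model7.
Variable R : realType.
Local Notation V := 'rV[R]_7.
Implicit Types x y z w u v : V.

Definition coord x (m : nat) : R := x 0 (inord m).

Lemma coordD x y m : coord (x + y) m = coord x m + coord y m.
Proof. by rewrite /coord mxE. Qed.

Lemma coordZ (c : R) x m : coord (c *: x) m = c * coord x m.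
Proof. by rewrite /coord mxE. Qed.

Lemma coordN x m : coord (- x) m = - coord x m.
Proof. by rewrite /coord mxE. Qed.

Lemma coord_inj x y : (forall m, (m < 7)%N -> coord x m = coord y m) -> x = y.
Proof.
by move=> xy; apply/rowP => i; rewrite -(inord_val i); apply: xy.
Qed.

Lemma dotE x y : dot x y = coord x 0 * coord y 0 + coord x 1 * coord y 1 +
  coord x 2 * coord y 2 + coord x 3 * coord y 3 + coord x 4 * coord y 4 +
  coord x 5 * coord y 5 + coord x 6 * coord y 6.
Proof.
rewrite /dot (eq_bigr (fun i : 'I_7 => coord x i * coord y i)); last first.
  by move=> i _; rewrite /coord inord_val.
by rewrite !big_ord_recr big_ord0 /= add0r.
Qed.

(** Entry m collects the terms of [phi0] that contain the covector of index m, with that covector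
    moved to the last place; [dot_cross7] confirms it. *)
Definition cross7_coords x y : seq R :=
  let p i j := coord x i * coord y j - coord x j * coord y i in
  [:: p 1 2 + p 3 4 + p 5 6;
      p 2 0 + p 3 5 + p 6 4;
      p 0 1 + p 6 3 + p 5 4;
      p 4 0 + p 5 1 + p 2 6;
      p 0 3 + p 1 6 + p 2 5;
      p 6 0 + p 1 3 + p 4 2;
      p 0 5 + p 4 1 + p 3 2].

Definition cross7 x y : V := \row_m (cross7_coords x y)`_m.

Lemma coord_cross7 x y m :
  (m < 7)%N -> coord (cross7 x y) m = (cross7_coords x y)`_m.
Proof. by move=> m7; rewrite /coord mxE inordK. Qed.

(** The 3 by 3 minor of x, y, z in the columns i, j, k, expanded along column k. *)
Definition minor3 i j k x y z : R :=
  (coord x i * coord y j - coord x j * coord y i) * coord z k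
  - (coord x i * coord z j - coord x j * coord z i) * coord y k
  + (coord y i * coord z j - coord y j * coord z i) * coord x k.

Lemma dual_basis_form m : is_form (@dual_basis R m).
Proof.
rewrite /dual_basis; split=> [v i c x y|v i j].
  by rewrite (ord1 i) !dfwithin !mxE.
by rewrite !ord1.
Qed.

Lemma e3_form i j k : is_form (@e3 R i j k).
Proof.
have dF := dual_basis_form.
exact: wedge_form (wedge_form (dF _) (dF _)) (dF _).
Qed.

Lemma e3E i j k x y z :
  on_seq (@e3 R i.+1 j.+1 k.+1) [:: x; y; z] = minor3 i j k x y z.
Proof.
have dF := dual_basis_form.
rewrite /e3 (@on_seq_wedge _ _ 2 1 _ _ _ (wedge_form (dF _) (dF _))) //.
rewrite /= !(@on_seq_wedge _ _ 1 1) //= /on_seq /dual_basis /= /minor3 /coord.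
by rewrite expr0 expr1 expr2; ring.
Qed.

Lemma phi0_form : is_form (@phi0 R).
Proof.
have F := e3_form.
exact: is_formB (is_formB (is_formB (is_formD (is_formD (is_formD
  (F 1 2 3) (F 1 4 5)) (F 1 6 7)) (F 2 4 6)) (F 2 5 7)) (F 3 4 7)) (F 3 5 6).
Qed.

Definition phi7 x y z : R := on_seq (@phi0 R) [:: x; y; z].

Lemma phi7E x y z : phi7 x y z =
  minor3 0 1 2 x y z + minor3 0 3 4 x y z + minor3 0 5 6 x y z
  + minor3 1 3 5 x y z - minor3 1 4 6 x y z - minor3 2 3 6 x y z
  - minor3 2 4 5 x y z.
Proof. by rewrite -!e3E. Qed.

Lemma dot_cross7 x y z : dot (cross7 x y) z = phi7 x y z.
Proof.
rewrite dotE !coord_cross7 // /cross7_coords /= phi7E /minor3; ring.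
Qed.

Lemma dotC x y : dot x y = dot y x.
Proof. by apply: eq_bigr => i _; rewrite mulrC. Qed.

Lemma dotDl x y z : dot (x + y) z = dot x z + dot y z.
Proof. by rewrite !dotE !coordD; ring. Qed.

Lemma dotZl (c : R) x y : dot (c *: x) y = c * dot x y.
Proof. by rewrite !dotE !coordZ; ring. Qed.

Lemma dot0l x : dot 0 x = 0.
Proof. by rewrite /dot big1 // => i _; rewrite mxE mul0r. Qed.

Lemma dotDr x y z : dot z (x + y) = dot z x + dot z y.
Proof. by rewrite !(dotC z) dotDl. Qed.

Lemma dotZr (c : R) x y : dot y (c *: x) = c * dot y x.
Proof. by rewrite !(dotC y) dotZl. Qed.

Lemma cross7Dl x y z : cross7 (x + y) z = cross7 x z + cross7 y z.
Proof.
apply: coord_inj => m m7;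
  rewrite coordD !coord_cross7 // /cross7_coords !coordD.
by do 7?[case: m m7 => [|m] m7 //=; first by ring].
Qed.

Lemma cross7C x y : cross7 y x = - cross7 x y.
Proof.
apply: coord_inj => m m7;
  rewrite -scaleN1r coordZ !coord_cross7 // /cross7_coords.
by do 7?[case: m m7 => [|m] m7 //=; first by ring].
Qed.

Lemma cross7Zl (c : R) x y : cross7 (c *: x) y = c *: cross7 x y.
Proof.
apply: coord_inj => m m7;
  rewrite coordZ !coord_cross7 // /cross7_coords !coordZ.
by do 7?[case: m m7 => [|m] m7 //=; first by ring].
Qed.

Lemma cross7Dr x y z : cross7 z (x + y) = cross7 z x + cross7 z y.
Proof. by rewrite !(cross7C _ z) cross7Dl opprD. Qed.

Lemma cross7Zr (c : R) x y : cross7 y (c *: x) = c *: cross7 y x.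
Proof. by rewrite !(cross7C _ y) cross7Zl scalerN. Qed.

Lemma dot_cross7_cross7 x y z :
  dot (cross7 x y) (cross7 x z) = dot x x * dot y z - dot x y * dot x z.
Proof. by rewrite !dotE !coord_cross7 // /cross7_coords /=; ring. Qed.

Lemma cross7_cross7 x y : cross7 x (cross7 x y) = dot x y *: x - dot x x *: y.
Proof.
rewrite -scaleNr; apply: coord_inj => m m7;
  rewrite coordD !coordZ coord_cross7 // /cross7_coords.
rewrite !coord_cross7 // /cross7_coords !dotE.
by do 7?[case: m m7 => [|m] m7 //=; first by ring].
Qed.

Lemma phi7C x y z : phi7 y x z = - phi7 x y z.
Proof. by rewrite !phi7E /minor3; ring. Qed.

Lemma phi7_rot x y z : phi7 y z x = phi7 x y z.
Proof. by rewrite !phi7E /minor3; ring. Qed.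

(* Polarization of cross7_cross7. *)
Lemma cross7_cross7_sym x y z :
  cross7 x (cross7 y z) + cross7 y (cross7 x z) =
  dot x z *: y + dot y z *: x - (2 * dot x y) *: z.
Proof.
have := cross7_cross7 (x + y) z.
rewrite !(cross7Dl, cross7Dr) !cross7_cross7.
rewrite !(dotDl, dotDr) (dotC y x) => xyz.
apply: coord_inj => m m7.
move/(congr1 (coord^~ m)): xyz; rewrite !(coordD, coordN, coordZ) => xyz.
apply: (addrI (dot x z * coord x m - dot x x * coord z m
   + (dot y z * coord y m - dot y y * coord z m))).
transitivity ((dot x z + dot y z) * (coord x m + coord y m)
  - (dot x x + dot x y + (dot x y + dot y y)) * coord z m); last by ring.
by rewrite -xyz; ring.
Qed.

(** The left side is minus the inner product of z X (u X y) with u X x. The symmetrized identity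
    exchanges z and u, and in the resulting product of u X (z X y) with u X x the common factor u is
    removed by [dot_cross7_cross7]. *)
Lemma phi7_cross7_cross7 u x y z : phi7 (cross7 u x) (cross7 u y) z =
  - dot u u * phi7 x y z + dot u x * phi7 u y z - dot u y * phi7 u x z
  + 2 * dot u z * phi7 u x y.
Proof.
rewrite -[LHS]phi7_rot phi7C -dot_cross7.
have := congr1 (fun w => dot w (cross7 u x)) (cross7_cross7_sym z u y).
rewrite -scaleNr !(dotDl, dotZl) dot_cross7_cross7 (dotC u (cross7 u x)).
rewrite !(dotC _ (cross7 u x)) !(dotC _ (cross7 z y)) !dot_cross7 (dotC z u).
have -> : phi7 u x u = 0 by rewrite phi7E /minor3; ring.
have -> : phi7 z y x = - phi7 x y z by rewrite phi7C phi7_rot.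
have -> : phi7 z y u = - phi7 u y z by rewrite phi7C phi7_rot.
by move/(canRL (addrK _)) => ->; ring.
Qed.

End Model7.

(* phi0 and psi7 on basis vectors are tabulated as integers, so that the sums
   over shuffles can be evaluated by computation. *)
Definition minor_table (a b c i j k : nat) : int :=
  ((i == a)%:Z * (j == b)%:Z - (i == b)%:Z * (j == a)%:Z) * (k == c)%:Z
  - ((i == a)%:Z * (k == b)%:Z - (i == b)%:Z * (k == a)%:Z) * (j == c)%:Z
  + ((j == a)%:Z * (k == b)%:Z - (j == b)%:Z * (k == a)%:Z) * (i == c)%:Z.

Definition phi_table (i j k : nat) : int :=
  minor_table 0 1 2 i j k + minor_table 0 3 4 i j k + minor_table 0 5 6 i j k
  + minor_table 1 3 5 i j k - minor_table 1 4 6 i j k - minor_table 2 3 6 i j k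
  - minor_table 2 4 5 i j k.

Ltac eval_phi_table := repeat match goal with
  |- context [phi_table ?i ?j ?k] =>
    let t := eval vm_compute in (phi_table i j k) in
    rewrite (_ : phi_table i j k = t); last by vm_compute
  end.

(** * The metric equation for [phi0], by evaluation on the standard basis *)

Section StandardBasis.
Variable R : realType.
Local Notation V := 'rV[R]_7.
Implicit Types x y z w u v : V.
Local Notation d m := (delta_mx 0 (inord m) : V).

Lemma coord_delta i m : (i < 7)%N -> (m < 7)%N -> coord (d i) m = (i == m)%:R.
Proof. by move=> i7 m7;
  rewrite /coord mxE eqxx -(inj_eq val_inj) /= !inordK // eq_sym. Qed.

Lemma dot_delta x m : (m < 7)%N -> dot x (d m) = coord x m.
Proof.
move=> m7; rewrite dotE !coord_delta //.
by do 7?[case: m m7 => [|m] m7 //=; first by ring].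
Qed.

Lemma std_basis_list : [seq delta_mx 0 i : V | i <- enum 'I_7] =
  [:: d 0; d 1; d 2; d 3; d 4; d 5; d 6].
Proof.
transitivity [seq d m | m <- [seq val i | i <- enum 'I_7]].
  by rewrite -map_comp; apply: eq_map => i /=; rewrite inord_val.
by rewrite val_enum_ord.
Qed.

Lemma phi7_delta i j k : (i < 7)%N -> (j < 7)%N -> (k < 7)%N ->
  phi7 (d i) (d j) (d k) = (phi_table i j k)%:~R.
Proof.
move=> i7 j7 k7; rewrite phi7E.
suff mE a b c : (a < 7)%N -> (b < 7)%N -> (c < 7)%N ->
    minor3 a b c (d i) (d j) (d k) = (minor_table a b c i j k)%:~R :> R.
  by rewrite !mE // /phi_table /minor_table !(intrD, mulrNz).
move=> a7 b7 c7; rewrite /minor3 /minor_table !coord_delta //.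
by rewrite !(intrD, mulrNz, intrM) -!pmulrn.
Qed.

Lemma coord_cross7_phi7 x y m : (m < 7)%N -> coord (cross7 x y) m =
  phi7 x y (d m).
Proof. by move=> m7; rewrite -dot_cross7 dot_delta. Qed.

Lemma phi7_delta2 u i j : (i < 7)%N -> (j < 7)%N -> phi7 u (d i) (d j) =
  coord u 0 * (phi_table i j 0)%:~R + coord u 1 * (phi_table i j 1)%:~R +
  coord u 2 * (phi_table i j 2)%:~R + coord u 3 * (phi_table i j 3)%:~R +
  coord u 4 * (phi_table i j 4)%:~R + coord u 5 * (phi_table i j 5)%:~R +
  coord u 6 * (phi_table i j 6)%:~R.
Proof.
move=> i7 j7; rewrite -phi7_rot -dot_cross7 dotC dotE.
by rewrite !coord_cross7_phi7 // !phi7_delta.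
Qed.

Lemma wedge_contractions u v x y z w :
  on_seq (wedge (Defs.contraction u (@phi0 R)) (Defs.contraction v (@phi0 R)))
    [:: x; y; z; w] =
  phi7 u x y * phi7 v z w - phi7 u x z * phi7 v y w + phi7 u x w * phi7 v y z
  + phi7 u y z * phi7 v x w - phi7 u y w * phi7 v x z + phi7 u z w * phi7 v x y.
Proof.
have cF t := contraction_form t (@phi0_form R).
rewrite (@on_seq_wedge _ _ 2 2) //= !on_seq_contraction -!/(phi7 _ _ _).
ring.
Qed.

(** Of the 35 shuffles, only those survive in which b receives one of the seven triples of [phi0]; a
    then receives the complementary quadruple. Keeping a and e abstract lets the recursion unfold
    without unfolding forms. *)
Lemma shuffle_phi_table (T : Type) (e : nat -> T) (a b : seq T -> R) :
  (forall i j k, (i < 7)%N -> (j < 7)%N -> (k < 7)%N ->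
    b [:: e i; e j; e k] = (phi_table i j k)%:~R) ->
  shuffle_prod 4 3 a b [:: e 0; e 1; e 2; e 3; e 4; e 5; e 6] =
  a [:: e 3; e 4; e 5; e 6] + a [:: e 1; e 2; e 5; e 6] + a [:: e 1; e 2; e 3;
    e 4]
  + a [:: e 0; e 2; e 4; e 6] - a [:: e 0; e 2; e 3; e 5] - a [:: e 0; e 1;
    e 4; e 5]
  - a [:: e 0; e 1; e 3; e 6].
Proof.
move=> bE; rewrite /= !bE //.
eval_phi_table.
ring.
Qed.

(** Both sides are top forms in x, so they are compared on the standard basis alone, where the
    tables reduce the claim to a polynomial identity in the coordinates of u and v. *)
Lemma metric_equation u v (x : 'I_7 -> V) :
  wedge (wedge (Defs.contraction u (@phi0 R)) (Defs.contraction v (@phi0 R)))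
        (@phi0 R) x = 6 * dot u v * \det (\matrix_i x i).
Proof.
have phiF := @phi0_form R.
have uvF := wedge_form (contraction_form u phiF) (contraction_form v phiF).
rewrite (@top_form_det R 7 _ x (wedge_form uvF phiF)); congr (_ * _).
rewrite (wedge_shuffle _ uvF phiF) std_basis_list.
rewrite (@shuffle_phi_table _ (fun m => d m)); last exact: phi7_delta.
rewrite !wedge_contractions !phi7_delta2 // dotE.
eval_phi_table.
ring.
Qed.

End StandardBasis.

(** * The Hodge dual of [phi0] *)

Definition psi_table (i j k l : nat) : int :=
  phi_table i j 0 * phi_table k l 0 + phi_table i j 1 * phi_table k l 1 +
  phi_table i j 2 * phi_table k l 2 + phi_table i j 3 * phi_table k l 3 +
  phi_table i j 4 * phi_table k l 4 + phi_table i j 5 * phi_table k l 5 +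
  phi_table i j 6 * phi_table k l 6
  - (i == k)%:Z * (j == l)%:Z + (i == l)%:Z * (j == k)%:Z.

Ltac eval_psi_table := repeat match goal with
  |- context [psi_table ?i ?j ?k ?l] =>
    let t := eval vm_compute in (psi_table i j k l) in
    rewrite (_ : psi_table i j k l = t); last by vm_compute
  end.

Section Star7.
Variable R : realType.
Local Notation V := 'rV[R]_7.
Implicit Types x y z w u : V.
Local Notation d m := (delta_mx 0 (inord m) : V).

(* Closed form of the Hodge dual of phi0; see psi0_star. *)
Definition psi7 x y z w : R :=
  dot (cross7 x y) (cross7 z w) - dot x z * dot y w + dot x w * dot y z.

Lemma psi7_swap12 x y z w : psi7 y x z w = - psi7 x y z w.
Proof. by rewrite /psi7 (cross7C x y) -scaleN1r dotZl; ring. Qed.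

Lemma psi7_swap34 x y z w : psi7 x y w z = - psi7 x y z w.
Proof. by rewrite /psi7 (cross7C z w) -scaleN1r dotZr; ring. Qed.

(** The formula for [psi7] shows antisymmetry only inside the pairs 12 and 34. Across the middle it
    amounts to the product formula for two cross products with a common factor. *)
Lemma psi7_diag23 x y w : psi7 x y y w = 0.
Proof.
rewrite /psi7 (cross7C y x) -scaleN1r dotZl dot_cross7_cross7 (dotC y x).
ring.
Qed.

Lemma psi7_linear1 (c : R) x x' y z w :
  psi7 (c *: x + x') y z w = c * psi7 x y z w + psi7 x' y z w.
Proof. by rewrite /psi7 cross7Dl cross7Zl !(dotDl, dotZl); ring. Qed.

Lemma psi7_linear3 (c : R) x y z z' w :
  psi7 x y (c *: z + z') w = c * psi7 x y z w + psi7 x y z' w.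
Proof.
by rewrite /psi7 cross7Dl cross7Zl !(dotDr, dotZr); ring.
Qed.

Lemma psi7_linear2 (c : R) x y y' z w :
  psi7 x (c *: y + y') z w = c * psi7 x y z w + psi7 x y' z w.
Proof. by rewrite psi7_swap12 psi7_linear1 !(psi7_swap12 x); ring. Qed.

Lemma psi7_linear4 (c : R) x y z w w' :
  psi7 x y z (c *: w + w') = c * psi7 x y z w + psi7 x y z w'.
Proof. by rewrite psi7_swap34 psi7_linear3 !(psi7_swap34 _ _ z); ring. Qed.

Definition psi0 : kform V 4 := fun v =>
  psi7 (v (@Ordinal 4 0 isT)) (v (@Ordinal 4 1 isT))
       (v (@Ordinal 4 2 isT)) (v (@Ordinal 4 3 isT)).

Lemma psi0_form : is_form psi0.
Proof.
split=> [v i c x y|v i j ij vij].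
  have dfE z j : @dfwith _ _ v i z j = if val i == val j then z else v j.
    by rewrite val_eqE; case: eqVneq => [<-|ij]; rewrite ?dfwithin // dfwithout.
  rewrite /psi0 !dfE; case: i {dfE} => [[|[|[|[|//]]]] i4] /=.
  - exact: psi7_linear1.
  - exact: psi7_linear2.
  - exact: psi7_linear3.
  - exact: psi7_linear4.
(* For the pairs of slots 12 and 34 the value equals its own opposite; swaps carry the pairs 13, 24
   and 14 to the middle pair. *)
have p12 x z w : psi7 x x z w = 0.
  by have := psi7_swap12 x x z w; lra.
have p34 x y z : psi7 x y z z = 0.
  by have := psi7_swap34 x y z z; lra.
have p13 x y w : psi7 x y x w = 0.
  by rewrite psi7_swap12 psi7_diag23 oppr0.
have p24 x y z : psi7 x y z y = 0.
  by rewrite psi7_swap34 psi7_diag23 oppr0.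
have p14 x y z : psi7 x y z x = 0.
  by rewrite psi7_swap34 p13 oppr0.
have vE m (m4 m4' : (m < 4)%N) : v (Ordinal m4) = v (Ordinal m4').
  by congr v; apply: val_inj.
rewrite /psi0; case: i ij vij => [[|[|[|[|//]]]] i4];
  case: j => [[|[|[|[|//]]]] j4] // _;
  rewrite (vE _ i4 isT) (vE _ j4 isT) => ->;
  by rewrite ?p12 ?p34 ?p13 ?p24 ?p14 ?psi7_diag23.
Qed.

Lemma psi7_delta i j k l :
  (i < 7)%N -> (j < 7)%N -> (k < 7)%N -> (l < 7)%N ->
  psi7 (d i) (d j) (d k) (d l) = (psi_table i j k l)%:~R.
Proof.
move=> i7 j7 k7 l7; rewrite /psi7 !dot_delta // !coord_delta // dotE.
rewrite !coord_cross7_phi7 // !phi7_delta //.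
rewrite /psi_table.
move: (phi_table i j 0) (phi_table i j 1) (phi_table i j 2) (phi_table i j 3)
  (phi_table i j 4) (phi_table i j 5) (phi_table i j 6)
  (phi_table k l 0) (phi_table k l 1) (phi_table k l 2) (phi_table k l 3)
    (phi_table k l 4) (phi_table k l 5) (phi_table k l 6) => p0 p1 p2 p3 p4 p5
      p6 q0 q1 q2 q3 q4 q5 q6.
by rewrite !(intrD, mulrNz, intrM) -!pmulrn.
Qed.

(** The quadruples on which b does not vanish are the complements of the seven triples of [phi0], so
    a is evaluated on those triples, with the signs of [phi0]. *)
Lemma shuffle_psi_table (T : Type) (e : nat -> T) (a b : seq T -> R) :
  (forall i j k l, (i < 7)%N -> (j < 7)%N -> (k < 7)%N -> (l < 7)%N ->
    b [:: e i; e j; e k; e l] = (psi_table i j k l)%:~R) ->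
  shuffle_prod 3 4 a b [:: e 0; e 1; e 2; e 3; e 4; e 5; e 6] =
  a [:: e 0; e 1; e 2] + a [:: e 0; e 3; e 4] + a [:: e 0; e 5; e 6]
  + a [:: e 1; e 3; e 5] - a [:: e 1; e 4; e 6] - a [:: e 2; e 3; e 6]
  - a [:: e 2; e 4; e 5].
Proof.
move=> bE; rewrite /= !bE //.
eval_psi_table.
ring.
Qed.

Lemma map_enum3 (T : Type) (v : 'I_3 -> T) : [seq v i | i <- enum 'I_3] =
  [:: v (@Ordinal 3 0 isT); v (@Ordinal 3 1 isT); v (@Ordinal 3 2 isT)].
Proof.
have -> : enum 'I_3 = [:: @Ordinal 3 0 isT; @Ordinal 3 1 isT; @Ordinal 3 2 isT].
  by apply: (inj_map val_inj); rewrite val_enum_ord.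
by [].
Qed.

(** The six orderings of i, j, k contribute equally because c and the covector product change sign
    together; this cancels the factor 1/3!. *)
Lemma form_inner_e3 (c : kform V 3) i j k : is_form c ->
  (i < 7)%N -> (j < 7)%N -> (k < 7)%N ->
  form_inner (fun m : 'I_7 => delta_mx 0 m) c (@e3 R i.+1 j.+1 k.+1) =
  on_seq c [:: d i; d j; d k].
Proof.
move=> cF i7 j7 k7; rewrite /form_inner.
(* The part of the sum belonging to one monomial of the minor; the index map (p, q, r) alone
   contributes to it. *)
pose mono p q r := \sum_(I : {ffun 'I_3 ->
  'I_7}) c (fun m => delta_mx 0 (I m)) *
  ((I (@Ordinal 3 0 isT) == inord p)%:R * (I (@Ordinal 3 1 isT) == inord q)%:R *
   (I (@Ordinal 3 2 isT) == inord r)%:R).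
have monoE p q r : mono p q r = on_seq c [:: d p; d q; d r].
  pose J : {ffun 'I_3 -> 'I_7} := [ffun m : 'I_3 => inord (nth 0%N [:: p; q;
    r] m)].
  rewrite /mono (bigD1 J) //= !ffunE !eqxx !mulr1 big1 ?addr0.
    congr c; apply/funext => m; rewrite ffunE.
    by case: m => [[|[|[|//]]] m3].
  move=> I IJ; case: eqP => [I0|_]; last by rewrite !mul0r mulr0.
  case: eqP => [I1|_]; last by rewrite mulr0 mul0r mulr0.
  case: eqP => [I2|_]; last by rewrite !mulr0.
  case/eqP: IJ; apply/ffunP => m; rewrite ffunE.
  by case: m => [[|[|[|//]]] m3] /=; rewrite -?I0 -?I1 -?I2; congr (I _);
    apply: val_inj.
have cA := form_alternating cF.
have swap12 x y z : on_seq c [:: y; x; z] = - on_seq c [:: x; y; z].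
  exact: (cA [::] [:: z]).
have swap23 x y z : on_seq c [:: x; z; y] = - on_seq c [:: x; y; z].
  exact: (cA [:: x] [::]).
transitivity (6^-1 * (mono i j k - mono j i k + mono j k i - mono i k j
   + mono k i j - mono k j i)).
  congr (_ * _); rewrite -!sumrN -!big_split /=; apply: eq_bigr => I _.
  rewrite (on_seq_enum (@e3 R _ _ _)) map_enum3 e3E /minor3 /coord !mxE /=.
  rewrite !(eq_sym (inord _)); move: (c _) => cI.
  by do !move: (_ == _)%:R => ?; ring.
rewrite !monoE.
set x := d i; set y := d j; set z := d k.
rewrite (swap12 y z x) (swap12 x z y) (swap23 y x z) (swap23 x y z) (swap12 x y
  z).
by field.
Qed.

Lemma form_inner_phi0 (c : kform V 3) : is_form c ->
  form_inner (fun m : 'I_7 => delta_mx 0 m) c (@phi0 R) =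
  on_seq c [:: d 0; d 1; d 2] + on_seq c [:: d 0; d 3; d 4]
  + on_seq c [:: d 0; d 5; d 6] + on_seq c [:: d 1; d 3; d 5]
  - on_seq c [:: d 1; d 4; d 6] - on_seq c [:: d 2; d 3; d 6]
  - on_seq c [:: d 2; d 4; d 5].
Proof.
move=> cF; rewrite -!form_inner_e3 // /form_inner -!mulrDr.
rewrite -!mulrBr; congr (_ * _).
rewrite -!sumrN -!big_split /=; apply: eq_bigr => I _.
by rewrite /phi0; ring.
Qed.

(** The frame may be taken standard, and both sides are top forms in v; on the standard basis each
    is the same signed sum of seven values of c. *)
Lemma psi0_star (e v : 'I_7 -> V) (c : kform V 3) :
  orthonormal_frame (@dot R 7) e -> is_form c ->
  wedge c psi0 v = form_inner e c (@phi0 R) * \det (\matrix_i v i).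
Proof.
move=> eo cF; have [cL _] := cF; have [phiL _] := @phi0_form R.
rewrite (form_inner_orthonormal cL phiL eo) form_inner_phi0 //.
rewrite (@top_form_det R 7 _ v (wedge_form cF psi0_form)); congr (_ * _).
rewrite (wedge_shuffle _ cF psi0_form) std_basis_list.
by rewrite (@shuffle_psi_table _ (fun m => d m)) //; exact: psi7_delta.
Qed.

(** When a takes the values of e^{123}, every shuffle but the identity vanishes. *)
Lemma shuffle_minor_table (T : Type) (e : nat -> T) (a b : seq T -> R) :
  (forall i j k, (i < 7)%N -> (j < 7)%N -> (k < 7)%N ->
    a [:: e i; e j; e k] = (minor_table 0 1 2 i j k)%:~R) ->
  shuffle_prod 3 4 a b [:: e 0; e 1; e 2; e 3; e 4; e 5; e 6] =
  b [:: e 3; e 4; e 5; e 6].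
Proof.
move=> aE; rewrite /= !aE // /minor_table /=.
ring.
Qed.

(* Given a 4-tuple J of indices, wedging b with the 3-form dual to three basis
   vectors outside J isolates the value of b on J. *)
Lemma wedge_eq0 (b : kform V 4) : is_form b ->
  (forall c : kform V 3, is_form c -> forall v, wedge c b v = 0) ->
  forall v, b v = 0.
Proof.
move=> bF cb0; apply: multilinear_eq0 => [|J]; first by case: bF.
(* The image of J has at most 4 of the 7 indices, so at least 3 lie outside. *)
have : (2 < #|~: [set J i | i : 'I_4]|)%N.
  have := cardsC [set J i | i : 'I_4]; rewrite card_ord.
  have := leq_imset_card J (mem 'I_4); rewrite card_ord.
  by move: #|_| #|_| => p q; lia.
move/card_gt2P => [p [q [r [[]]]]]; rewrite !inE => pJ qJ rJ [pq qr rp].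
have Jn t : t \notin [set J i | i : 'I_4] -> forall i, (J i == t) = false.
  by move=> tJ i; apply: contraNF tJ => /eqP <-; apply: imset_f.
pose o m m4 := J (@Ordinal 4 m m4).
(* The last four entries may repeat but avoid p, q, r, so e^{pqr} takes on this list the values that
   e^{123} takes on the standard basis. *)
pose s := nth p [:: p; q; r; o 0 isT; o 1 isT; o 2 isT; o 3 isT].
pose e m : V := delta_mx 0 (s m).
have coordE t i : coord (e i) t =
  (s i == inord t)%:R by rewrite /coord mxE eqxx eq_sym.
have s0 i : (i < 7)%N -> (s i == p) = (i == 0%N).
  by do 7?[case: i => [|i] //=];
    rewrite /s /= ?Jn // ?eqxx ?(negbTE rp) // eq_sym (negbTE pq).
have s1 i : (i < 7)%N -> (s i == q) = (i == 1%N).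
  by do 7?[case: i => [|i] //=];
    rewrite /s /= ?Jn // ?eqxx ?(negbTE pq) // eq_sym (negbTE qr).
have s2 i : (i < 7)%N -> (s i == r) = (i == 2%N).
  by do 7?[case: i => [|i] //=];
    rewrite /s /= ?Jn // ?eqxx ?(negbTE qr) // eq_sym (negbTE rp).
have := cb0 _ (@e3_form R p.+1 q.+1 r.+1)
  (fun i : 'I_7 => [:: e 0; e 1; e 2; e 3; e 4; e 5; e 6]`_i).
rewrite (wedge_shuffle _ (@e3_form R _ _ _) bF) map_nth_enum //.
rewrite shuffle_minor_table => [<-|i j k i7 j7 k7].
  congr b; apply/funext => i.
  by case: i => [[|[|[|[|//]]]] i4] /=; congr (delta_mx _ (J _));
    apply: val_inj.
rewrite e3E /minor3 /minor_table !coordE !inord_val !(s0, s1, s2) //.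
by rewrite !(intrD, mulrNz, intrM) -!pmulrn.
Qed.

End Star7.

(** * The model identity for [phi7] under the adjoint action *)

Section AdjointIdentity.
Variable R : realType.
Local Notation V := 'rV[R]_7.
Implicit Types x y z w u b : V.

Lemma psi7_swap23 x y z w : psi7 x z y w = - psi7 x y z w.
Proof.
have := psi7_diag23 x (y + z) w.
rewrite -{1}[y]scale1r -{2}[y]scale1r psi7_linear2 !psi7_linear3 !psi7_diag23.
by rewrite !mul1r add0r addr0 addrC => /eqP; rewrite addr_eq0 => /eqP.
Qed.

Lemma psi7Zl (c : R) x y z w : psi7 (c *: x) y z w = c * psi7 x y z w.
Proof. by rewrite /psi7 cross7Zl !dotZl; ring. Qed.

Lemma dot_cross7_self b x : dot b (cross7 b x) = 0.
Proof.
by rewrite dotC dot_cross7 phi7E /minor3; ring.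
Qed.

Lemma phi7_cross7 b x y z :
  phi7 (cross7 b x) y z = psi7 b x y z + dot b y * dot x z - dot b z * dot x y.
Proof. by rewrite -phi7_rot -dot_cross7 dotC /psi7; ring. Qed.

Lemma phi7Dl x x' y z : phi7 (x + x') y z = phi7 x y z + phi7 x' y z.
Proof. by rewrite -!dot_cross7 cross7Dl dotDl. Qed.

Lemma phi7Zl (c : R) x y z : phi7 (c *: x) y z = c * phi7 x y z.
Proof. by rewrite -!dot_cross7 cross7Zl dotZl. Qed.

Lemma phi7Dm x y y' z : phi7 x (y + y') z = phi7 x y z + phi7 x y' z.
Proof. by rewrite -!dot_cross7 cross7Dr dotDl. Qed.

Lemma phi7Zm (c : R) x y z : phi7 x (c *: y) z = c * phi7 x y z.
Proof. by rewrite -!dot_cross7 cross7Zr dotZl. Qed.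

Lemma phi7Dr x y z z' : phi7 x y (z + z') = phi7 x y z + phi7 x y z'.
Proof. by rewrite -!dot_cross7 dotDr. Qed.

Lemma phi7Zr (c : R) x y z : phi7 x y (c *: z) = c * phi7 x y z.
Proof. by rewrite -!dot_cross7 dotZr. Qed.

(* (a^2 + |b|^2) Ad_(V^-1) for V = (a, b). *)
Definition ad7 (a : R) b x : V :=
  (a ^+ 2 - dot b b) *: x + (2 * dot b x) *: b + (- (2 * a)) *: cross7 b x.

(** Here q and k b are the real and imaginary parts of V^3, so the right side is |V^3|^2 times sigma
    of V^3 applied to the model form. *)
Lemma phi7_ad7 a b x y z :
  phi7 (ad7 a b x) (ad7 a b y) (ad7 a b z) =
  let q := a ^+ 3 - 3 * a * dot b b in let k := 3 * a ^+ 2 - dot b b in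
  (q ^+ 2 - k ^+ 2 * dot b b) * phi7 x y z - 2 * q * k * psi7 b x y z +
  2 * k ^+ 2 * (dot b x * phi7 b y z - dot b y * phi7 b x z + dot b z * phi7 b
    x y).
Proof.
have g1 u v w : phi7 (cross7 b u) v w =
    psi7 b u v w + dot b v * dot u w - dot b w * dot u v by exact: phi7_cross7.
have g2 u v w : phi7 u (cross7 b v) w =
    psi7 b u v w - dot b u * dot v w + dot b w * dot v u.
  by rewrite phi7C g1 psi7_swap23; ring.
have g3 u v w : phi7 u v (cross7 b w) =
    psi7 b u v w + dot b u * dot w v - dot b v * dot w u.
  by rewrite phi7_rot g1 psi7_swap23 psi7_swap34; ring.
have h12 u v w := phi7_cross7_cross7 b u v w.
have h13 u v w : phi7 (cross7 b u) v (cross7 b w) =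
  phi7 (cross7 b w) (cross7 b u) v.
  exact: phi7_rot.
have h23 u v w : phi7 u (cross7 b v) (cross7 b w) =
  phi7 (cross7 b v) (cross7 b w) u.
  by rewrite -phi7_rot.
have bb u : phi7 b b u = 0 by rewrite phi7E /minor3; ring.
have bub u : phi7 b u b = 0 by rewrite phi7E /minor3; ring.
have ubb u : phi7 u b b = 0 by rewrite phi7E /minor3; ring.
have pb2 u v : psi7 b b u v = 0 by have := psi7_swap12 b b u v; lra.
have pb3 u v : psi7 b u b v = 0 by rewrite psi7_swap23 pb2 oppr0.
have pb4 u v : psi7 b u v b = 0 by rewrite psi7_swap34 pb3 oppr0.
rewrite /ad7 !(phi7Dl, phi7Zl, phi7Dm, phi7Zm, phi7Dr, phi7Zr) /=.
(* Cross products are removed in pairs first; a single one that remains is turned into [psi7]. The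
   rewrites that follow bring all arguments into the order b, x, y, z for [ring]. *)
rewrite !(h12, h13, h23) !(g1, g2, g3) !dot_cross7_self !(bb, bub, ubb, pb2,
  pb3, pb4).
have -> : phi7 z x y = phi7 x y z by rewrite -phi7_rot.
have yzx : phi7 y z x = phi7 x y z by rewrite phi7_rot.
have bC u : dot u b = dot b u by exact: dotC.
rewrite ?(bC x) ?(bC y) ?(bC z) ?(dotC y x) ?(dotC z x) ?(dotC z y) ?yzx.
have b2 u v : phi7 u b v = - phi7 b u v by exact: phi7C.
have bS u v : phi7 b v u = - phi7 b u v by rewrite -phi7_rot phi7C phi7_rot.
rewrite !(phi7_rot b) (b2 x) (bS x z) (bS x y) (bS y z).
ring.
Qed.

End AdjointIdentity.

(** * Transport of the model identity along a linear isomorphism *)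

Section Transport.
Variables (R : realType) (W : lmodType R) (L : {linear W -> 'rV[R]_7}).
Variable (M : 'rV[R]_7 -> W).
Hypotheses (LK : cancel L M) (MK : cancel M L).
Local Notation std := (fun i : 'I_7 => delta_mx 0 i : 'rV[R]_7).
Local Notation phi := (fun v : 'I_3 -> W => @phi0 R (fun i => L (v i))).

Lemma linear_inverse : linear M.
Proof. by move=> c x y; apply: (can_inj LK); rewrite linearP !MK. Qed.

Lemma linear_pullback : linear L.
Proof. by move=> c x y; rewrite linearP. Qed.

Definition pull_metric (u v : W) : R := dot (L u) (L v).
Definition pull_volume : kform W 7 := fun x => \det (\matrix_i L (x i)).
Definition pull_psi : kform W 4 := fun x => psi0 (fun i => L (x i)).

Lemma pull_metric_gt0 x : x != 0 -> 0 < pull_metric x x.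
Proof.
move=> x0; have /rV0Pn[i Li] : L x != 0.
  by apply: contra_neq x0 => Lx; rewrite -(LK x) Lx -[0](raddf0 L) LK.
rewrite /pull_metric /dot (bigD1 i) //= ltr_pwDl //.
  by rewrite -expr2 lt_def sqrf_eq0 Li sqr_ge0.
by apply: sumr_ge0 => j _; rewrite -expr2 sqr_ge0.
Qed.

Lemma pull_metric_equation u v x :
  pull_metric u v * pull_volume x =
  6^-1 * wedge (wedge (Defs.contraction u phi) (Defs.contraction v phi)) phi x.
Proof.
have cE w : Defs.contraction w phi =
    (fun v => Defs.contraction (L w) (@phi0 R) (fun i => L (v i))).
  by apply/funext => y; rewrite pullback_contraction.
rewrite !cE.
transitivity (6^-1 * (6 * dot (L u) (L v) * \det (\matrix_i L (x i)))).
  by rewrite /pull_metric /pull_volume; field.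
by rewrite -(metric_equation _ _ (fun i => L (x i))).
Qed.

Lemma pull_is_metric_vol : is_metric_vol phi (pull_metric, pull_volume).
Proof.
split.
- split=> [c x y z|x y|x]; last exact: pull_metric_gt0.
    by rewrite /pull_metric linearP dotDl dotZl.
  exact: dotC.
- exact: pullback_form linear_pullback (@det_form R 7).
- by move=> e eo; apply: orthonormal_det.
- exact: pull_metric_equation.
Qed.

(* The defining equation leaves the scalings g / t, t vol; the condition on
   orthonormal frames gives t^(9/2) = 1. *)
Lemma metric_vol_unique g vol :
  is_metric_vol phi (g, vol) -> (g, vol) = (pull_metric, pull_volume).
Proof.
move=> [[gL gC g_gt0] _ vol1 gvol].
pose e i := M (std i).
have gE u v x : g u v * vol x = pull_metric u v * pull_volume x.
  by rewrite gvol -pull_metric_equation.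
have vole (s : R) : pull_volume (fun i => s *: e i) = s ^+ 7.
  rewrite /pull_volume -[s ^+ 7]det_scalar; congr (\det _).
  by apply/matrixP => i j;
    rewrite !mxE linearZ /= /e MK !mxE eqxx mulr_natr eq_sym.
set t := vol e.
have tE u v : g u v * t = pull_metric u v.
  rewrite gE -[RHS]mulr1; congr (_ * _).
  by have := vole 1; rewrite expr1n => <-; congr pull_volume;
    apply/funext => i; rewrite scale1r.
have eo i j : pull_metric (e i) (e j) = (i == j)%:R.
  have := dot_delta (std i) (ltn_ord j);
    rewrite inord_val /pull_metric /e !MK => ->.
  by rewrite /coord inord_val mxE eqxx eq_sym.
have e0 : e ord0 != 0.
  apply/eqP => e00; have := eo ord0 ord0.
  rewrite e00 /pull_metric (raddf0 L) dot0l eqxx => /eqP.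
  by rewrite eq_sym oner_eq0.
have t_gt0 : 0 < t.
  by rewrite -(pmulr_rgt0 _ (g_gt0 _ e0)) tE eo eqxx ltr01.
pose s := Num.sqrt t.
have s_gt0 : 0 < s by rewrite sqrtr_gt0.
have s2 : s ^+ 2 = t by rewrite sqr_sqrtr // ltW.
have gZ c d u v : g (c *: u) (d *: v) = c * d * g u v.
  have gl c' u' v' : g (c' *: u') v' = c' * g u' v'.
    have g0 : g 0 v' = 0 by have := gL 1 0 0 v'; rewrite scale1r addr0; lra.
    by have := gL c' u' 0 v'; rewrite g0 !addr0.
  by rewrite gl gC gl gC mulrA.
(* Since g is [pull_metric] divided by t, stretching e by s = sqrt t makes it orthonormal for g. Its
   volume is t s^7 = s^9, and this must have absolute value 1. *)
have fo : orthonormal_frame g (fun i => s *: e i).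
  move=> i j; rewrite gZ -expr2 s2 -(eo i j) -tE; ring.
have s1 : s = 1.
  have := vol1 _ fo; have := gE (e ord0) (e ord0) (fun i => s *: e i).
  rewrite vole eo eqxx mul1r => volf.
  have : vol (fun i => s *: e i) = s ^+ 9.
    rewrite [s ^+ 9](exprD s 7 2) -volf s2.
    by rewrite mulrAC tE eo eqxx mul1r.
  move=> ->; rewrite ger0_norm ?exprn_ge0 ?ltW // => /eqP.
  by rewrite pexpr_eq1 // ?ltW // => /eqP.
have t1 : t = 1 by rewrite -s2 s1 expr1n.
have gM u v : g u v = pull_metric u v by rewrite -tE t1 mulr1.
congr (_, _); apply/funext => u; first by apply/funext => v.
by have := gE (e ord0) (e ord0) u; rewrite gM eo eqxx !mul1r.
Qed.

Lemma metric_volE : metric_vol phi = (pull_metric, pull_volume).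
Proof.
apply: xget_unique; first exact: pull_is_metric_vol.
by move=> [g vol]; apply: metric_vol_unique.
Qed.

Lemma metricE : metric phi = pull_metric.
Proof. by rewrite /metric metric_volE. Qed.

Lemma volumeE : volume phi = pull_volume.
Proof. by rewrite /volume metric_volE. Qed.

Lemma pull_psi_is_star : @is_star R W 3 4 pull_metric pull_volume phi pull_psi.
Proof.
split; first exact: pullback_form linear_pullback (@psi0_form R).
move=> e eo c cF v.
(* Every 3-form on W is pulled back from the model, so [psi0_star] covers all of them. *)
have cE : c = (fun x => c (fun i => M (L (x i)))).
  by apply/funext => x; congr c; apply/funext => i; rewrite LK.
have c'F : is_form (fun x => c (fun i => M (x i))).
  exact: pullback_form linear_inverse cF.
by rewrite cE; apply: (psi0_star (fun i => L (v i)) eo c'F).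
Qed.

(** Two duals have the same wedge with every 3-form; carried to the model, their difference vanishes
    by [wedge_eq0]. *)
Lemma star_unique b :
  @is_star R W 3 4 pull_metric pull_volume phi b -> b = pull_psi.
Proof.
move=> [bF bS]; have [pF pS] := pull_psi_is_star.
pose b' : kform 'rV[R]_7 4 := fun x => b (fun i => M (x i)) - psi0 x.
have b'F : is_form b'.
  exact: is_formB (pullback_form linear_inverse bF) (@psi0_form R).
have b'0 : forall x, b' x = 0.
  apply: wedge_eq0 => // c cF v.
  (* The star equation is available only through an orthonormal frame, so one has to be
     exhibited. *)
  have eo : orthonormal_frame pull_metric (fun i => M (std i)).
    move=> i j; have := dot_delta (std i) (ltn_ord j).
    rewrite inord_val /pull_metric !MK => ->.
    by rewrite /coord inord_val mxE eqxx eq_sym.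
  have cLF : is_form (fun x => c (fun i => L (x i))).
    exact: pullback_form linear_pullback cF.
  have := bS _ eo _ cLF (fun i => M (v i)).
  rewrite -(pS _ eo _ cLF (fun i => M (v i))) => wbp.
  have cE w : c (fun i => L (M (w i))) = c w.
    by congr c; apply/funext => i; rewrite MK.
  rewrite /wedge; transitivity (wedge (fun x => c (fun i => L (x i))) b (fun i
    => M (v i))
    - wedge (fun x => c (fun i => L (x i))) pull_psi (fun i => M (v i))).
    rewrite /wedge -mulrBr -sumrB; congr (_ * _); apply: eq_bigr => s _.
    rewrite -mulrBr /b' /pull_psi; congr (_ * _ * (_ - _)); first by rewrite cE.
    by congr psi0; apply/funext => i; rewrite MK.
  by rewrite wbp subrr.
apply/funext => x; have := b'0 (fun i => L (x i)).
rewrite /b' /pull_psi => /eqP; rewrite subr_eq0 => /eqP <-.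
by congr b; apply/funext => i; rewrite LK.
Qed.

Lemma psi_ofE : psi_of phi = pull_psi.
Proof.
rewrite /psi_of metricE volumeE; apply: xget_unique;
  first exact: pull_psi_is_star.
exact: star_unique.
Qed.

Lemma phiE x : phi x =
  phi7 (L (x (@Ordinal 3 0 isT))) (L (x (@Ordinal 3 1 isT)))
                            (L (x (@Ordinal 3 2 isT))).
Proof.
by rewrite -[LHS]/(@phi0 R (fun i => L (x i))) (on_seq_enum (@phi0 R))
  map_enum3.
Qed.

(** Pairing with the preimages of the basis vectors reads off every coordinate, so the equation
    defining [cross] has a unique solution. *)
Lemma L_cross u v : L (cross phi u v) = cross7 (L u) (L v).
Proof.
rewrite /cross metricE.
have -> : xget 0 [set w | forall c, pull_metric w c =
    phi (fun i : 'I_3 => [:: u; v; c]`_i)] = M (cross7 (L u) (L v)).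
  apply: xget_unique => [c|w wP];
    first by rewrite phiE /pull_metric MK dot_cross7.
  apply: (can_inj LK); rewrite MK; apply: coord_inj => m m7.
  rewrite -!dot_delta // dot_cross7.
  by have := wP (M (delta_mx 0 (inord m))); rewrite phiE /pull_metric /= MK.
by rewrite MK.
Qed.

(** The last three terms are the three (1,2)-shuffles of the wedge of the dual covector with the
    contraction. *)
Lemma sigmaE A v : let x := L (v (@Ordinal 3 0 isT)) in
  let y := L (v (@Ordinal 3 1 isT)) in let z := L (v (@Ordinal 3 2 isT)) in
  let b := L A.2 in
  sigma phi A v = (A.1 ^+ 2 + dot b b)^-1 *
  ((A.1 ^+ 2 - dot b b) * phi7 x y z - 2 * A.1 * psi7 b x y z
   + 2 * (dot b x * phi7 b y z - dot b y * phi7 b x z + dot b z * phi7 b x y)).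
Proof.
move=> x y z b.
have phiF : is_form phi by exact: pullback_form linear_pullback (@phi0_form R).
have flatF : is_form (flat pull_metric A.2).
  rewrite /flat /pull_metric; split=> [w i c s t|w i j]; last by rewrite !ord1.
  by rewrite (ord1 i) !dfwithin linearP dotDr dotZr.
rewrite /sigma /oct_inner metricE psi_ofE /pull_metric -/b expr2.
congr (_ * (_ * _ - _ * _ + _ * _)).
- exact: phiE.
- by rewrite (on_seq_enum (Defs.contraction _ _)) map_enum3 on_seq_contraction.
rewrite (@wedge_shuffle _ _ 1 2 _ _ v flatF (contraction_form A.2 phiF)).
rewrite (map_enum3 v) /= !on_seq_contraction.
have phisE s t u : on_seq phi [:: s; t;
  u] = phi7 (L s) (L t) (L u) by exact: phiE.
by rewrite !phisE /on_seq /flat /pull_metric /= -/b -/x -/y -/z; ring.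
Qed.

Lemma oct_mul_re A B : (oct_mul phi A B).1 = A.1 * B.1 - dot (L A.2) (L B.2).
Proof. by rewrite /= metricE. Qed.

Lemma oct_mul_im A B : L (oct_mul phi A B).2 =
  A.1 *: L B.2 + B.1 *: L A.2 + cross7 (L A.2) (L B.2).
Proof. by rewrite /= !linearD !linearZ L_cross. Qed.

Lemma oct_inv_re A : (oct_inv phi A).1 =
  (A.1 ^+ 2 + dot (L A.2) (L A.2))^-1 * A.1.
Proof. by rewrite /= /oct_inner metricE expr2. Qed.

Lemma oct_inv_im A : L (oct_inv phi A).2 =
  - (A.1 ^+ 2 + dot (L A.2) (L A.2))^-1 *: L A.2.
Proof.
by rewrite /= linearZ /= linearN scalerN -scaleNr /oct_inner metricE expr2.
Qed.

Lemma oct_norm_gt0 V : V != (0, 0) -> 0 < V.1 ^+ 2 + dot (L V.2) (L V.2).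
Proof.
case: V => a al /= V0; have [al0|al0] := eqVneq al 0; last first.
  by rewrite ltr_wpDl ?sqr_ge0 //; exact: pull_metric_gt0.
have a0 : a != 0 by apply: contraNneq V0 => ->; rewrite al0.
rewrite al0 (raddf0 L) dot0l addr0.
by rewrite lt_def sqrf_eq0 a0 sqr_ge0.
Qed.

(** As b X b = 0, the powers of V stay in the span of 1 and b, where they multiply like complex
    numbers. *)
Lemma oct_cubeE V : let a := V.1 in let n := dot (L V.2) (L V.2) in
  (oct_cube phi V).1 = a ^+ 3 - 3 * a * n /\
  L (oct_cube phi V).2 = (3 * a ^+ 2 - n) *: L V.2.
Proof.
have bb b : cross7 b b = 0 :> 'rV[R]_7.
  apply: coord_inj => m m7; rewrite coord_cross7_phi7 // phi7E /minor3.
  by rewrite [RHS]mxE; ring.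
move=> a n; rewrite /oct_cube !(oct_mul_re, oct_mul_im) bb addr0 {}/a {}/n.
split; first by rewrite !(dotDl, dotZl); ring.
rewrite !(cross7Dl, cross7Zl) bb scaler0 !addr0 scalerDr !scalerA -2!scalerDl.
by congr (_ *: _); ring.
Qed.

Lemma L_Ad V u : V != (0, 0) ->
  L (oct_Ad_im phi (oct_inv phi V) u) =
  (V.1 ^+ 2 + dot (L V.2) (L V.2))^-1 *: ad7 V.1 (L V.2) (L u).
Proof.
move=> /oct_norm_gt0; rewrite /oct_Ad_im /oct_Ad !(oct_mul_re, oct_mul_im).
rewrite !(oct_inv_re, oct_inv_im) -[(oct_of_im u).1]/(0 :
  R) -[(oct_of_im u).2]/u.
move: (L V.2) (L u) V.1 => b x a; set n := _ + _ => n_gt0.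
have nV : n^-1 * n = 1 by rewrite mulVf // gt_eqF.
(* The squared norm of V^-1 is 1/n; it enters because conjugation by V^-1 inverts V^-1 again. *)
have normV : (n^-1 * a) ^+ 2 + dot (- n^-1 *: b) (- n^-1 *: b) = n^-1.
  move: (n^-1) nV => k kn.
  by rewrite dotZl dotZr -[RHS]mulr1 -kn /n; ring.
rewrite normV invrK.
rewrite !(dotZl, dotZr, cross7Zl, cross7Zr, cross7Dl) (cross7C b x).
rewrite (cross7C b (cross7 b x)) cross7_cross7 !scale0r !addr0.
apply: coord_inj => m m7; rewrite /ad7 !(coordD, coordN, coordZ).
(* With a factor k n = 1 inserted on the right, the two sides agree as polynomials in k, whose
   relation to n can then be forgotten. *)
rewrite -[RHS]mul1r -[X in _ = X * _]nV {normV}; move: (n^-1) nV => k _.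
by rewrite /n; ring.
Qed.

Lemma sigma_cube_Ad V v : V != (0, 0) ->
  sigma phi (oct_cube phi V) v =
  phi (fun i => oct_Ad_im phi (oct_inv phi V) (v i)).
Proof.
move=> V0; have n_gt0 := oct_norm_gt0 V0; have [cube1 cube2] := oct_cubeE V.
have := sigmaE (oct_cube phi V) v; rewrite cube1 cube2 /= => ->.
have := phiE (fun i => oct_Ad_im phi (oct_inv phi V) (v i)).
rewrite /= !(L_Ad _ V0) => ->.
move: (L V.2) V.1 n_gt0 => b a n_gt0.
move: (L (v _)) (L (v _)) (L (v _)) => x y z.
rewrite !(phi7Zl, phi7Zm, phi7Zr) phi7_ad7 /= !(dotZl, dotZr) psi7Zl.
(* This is |V^3|^2 = |V|^6, which matches the three factors |V|^-2 given by [L_Ad], one per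
   argument. *)
have -> : (a ^+ 3 - 3 * a * dot b b) ^+ 2 +
    (3 * a ^+ 2 - dot b b) * ((3 * a ^+ 2 - dot b b) * dot b b) =
    (a ^+ 2 + dot b b) ^+ 3 by ring.
by field; rewrite gt_eqF.
Qed.

End Transport.

Theorem theorem4p5 (R : realType) (M : manifold7 R)
    (phi : forall p : M, kform (tangent p) 3) (hphi : G2_structure phi)
    (V : forall p : M, oct (tangent p)) (hV : oct_section V)
    (hV0 : nowhere_vanishing V) (p : M) (v : 'I_3 -> tangent p) :
  sigma (phi p) (oct_cube (phi p) (V p)) v =
  phi p (fun i => oct_Ad_im (phi p) (oct_inv (phi p) (V p)) (v i)).
Proof.
(* Positivity at p provides the isomorphism with the model that exhibits [phi p] as a pullback of
   [phi0]. *)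
have [_ _ /(_ p)[L [N LK NK] phiL]] := hphi.
have -> : phi p = (fun v : 'I_3 -> tangent p => @phi0 R (fun i => L (v i))).
  exact/funext.
by apply: (sigma_cube_Ad LK NK); apply/eqP; exact: hV0.
Qed.
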